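(* For every fixed constant $k$, there is a polynomial-time algorithm that, given a binary-classification tree ensemble $\mathcal{E}$ all of whose trees have depth $1$ over a feature set $\mathcal{F}$, a set $F\subseteq\mathcal{F}$ with $|\mathcal{F}\setminus F|\le k$, and a gap parameter $g\ge 0$, decides whether $\mathcal{E}$ is $(g,F)$-sensitive.
   Context: Inputs live in $\mathcal{X} \subseteq \mathbb{R}^d$ indexed by a feature set $\mathcal{F}$; $x_f$ is the value of feature $f$ in input $x$. A decision tree is either a leaf $n$ with a real value $n.val$, or an internal node $n$ with a guard $X_f < \tau$ and two children $n.yes$, $n.no$; an input $x$ goes to $n.yes$ if $x_f<\tau$ and to $n.no$ otherwise, and $T(x)$ is the value of the leaf reached. A depth-1 tree (decision stump) has a single internal node (root) whose two children are leaves. A binary tree ensemble $\mathcal{E}$ is a finite set $\mathcal{T}$ of trees with raw output $\mathcal{E}^{raw}_1(x)=\sum_{T\in\mathcal{T}}T(x)$ and probability $\mathcal{E}^{prob}_1(x)=1/(1+e^{-\mathcal{E}^{raw}_1(x)})$. Given $F\subseteq\mathcal{F}$ and $g\ge 0$, $\mathcal{E}$ is $(g,F)$-sensitive if there exist inputs $x^{(1)},x^{(2)}$ with $x^{(1)}_f=x^{(2)}_f$ for all $f\in\mathcal{F}\setminus F$, $\mathcal{E}^{prob}_1(x^{(1)})\ge 0.5+g$ and $\mathcal{E}^{prob}_1(x^{(2)})\le 0.5-g$. Running time is polynomial in the size of the ensemble (number of trees and features), with $k$ treated as a constant. *)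

(* Defs.v *)
From Stdlib Require Import Reals Lra Lia List Arith.
Import ListNotations.
Open Scope R_scope.

Record stump := Stump {
  st_feat : nat;
  st_thr : R;
  st_yes : R;
  st_no : R }.

(* An input x in R^d is a function nat -> R (only indices < d matter). *)
Definition stump_eval (s : stump) (x : nat -> R) : R :=
  if Rlt_dec (x (st_feat s)) (st_thr s) then st_yes s else st_no s.

(* A problem instance: feature set {0,..,d-1}, the ensemble (a finite list
   of depth-1 trees), the subset F of features (as a boolean predicate),
   and the gap g. *)
Record instance := Instance {
  inst_d : nat;
  inst_trees : list stump;
  inst_F : nat -> bool;
  inst_g : R }.

Definition wf_instance (I : instance) : Prop :=
  Forall (fun s => (st_feat s < inst_d I)%nat) (inst_trees I) /\ 0 <= inst_g I.

Definition raw_output (E : list stump) (x : nat -> R) : R :=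
  fold_right (fun s acc => stump_eval s x + acc) 0 E.

Definition prob_output (E : list stump) (x : nat -> R) : R :=
  / (1 + exp (- raw_output E x)).

Definition sensitive (I : instance) : Prop :=
  exists x1 x2 : nat -> R,
    (forall f, (f < inst_d I)%nat -> inst_F I f = false -> x1 f = x2 f) /\
    prob_output (inst_trees I) x1 >= 1/2 + inst_g I /\
    prob_output (inst_trees I) x2 <= 1/2 - inst_g I.

Definition n_fixed (I : instance) : nat :=
  length (filter (fun f => negb (inst_F I f)) (seq 0 (inst_d I))).

Definition inst_size (I : instance) : nat :=
  (length (inst_trees I) + inst_d I + 1)%nat.

(* 2. Machine model: a unit-cost real RAM (BSS-style register machine   *)
(*    over R with exp, plus natural-number registers for indexing).      *)

Inductive instr :=
| RZero (i : nat)
| ROne (i : nat)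
| RAdd (i j l : nat)
| RSub (i j l : nat)
| RMul (i j l : nat)
| RExp (i j : nat)
| RLoad (i a : nat)
| RStore (a i : nat)
| NZero (a : nat)
| NSucc (a : nat)
| NPred (a : nat)
| NLoad (a b : nat)
| NStore (a b : nat)
| JmpRLt (i j t : nat)
| JmpNZero (a t : nat)
| Jmp (t : nat)
| Halt.

Definition program := list instr.

Record state := State {
  pc : nat;
  rmem : nat -> R;
  nmem : nat -> nat }.

Definition updR (m : nat -> R) (i : nat) (v : R) : nat -> R :=
  fun j => if Nat.eqb j i then v else m j.
Definition updN (m : nat -> nat) (i : nat) (v : nat) : nat -> nat :=
  fun j => if Nat.eqb j i then v else m j.

(* One step; None means the machine has halted (Halt or pc out of range). *)
Definition step (P : program) (s : state) : option state :=
  let p := pc s in let r := rmem s in let n := nmem s in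
  let nx := S p in
  match nth_error P p with
  | None => None
  | Some Halt => None
  | Some (RZero i) => Some (State nx (updR r i 0) n)
  | Some (ROne i) => Some (State nx (updR r i 1) n)
  | Some (RAdd i j l) => Some (State nx (updR r i (r j + r l)) n)
  | Some (RSub i j l) => Some (State nx (updR r i (r j - r l)) n)
  | Some (RMul i j l) => Some (State nx (updR r i (r j * r l)) n)
  | Some (RExp i j) => Some (State nx (updR r i (exp (r j))) n)
  | Some (RLoad i a) => Some (State nx (updR r i (r (n a))) n)
  | Some (RStore a i) => Some (State nx (updR r (n a) (r i)) n)
  | Some (NZero a) => Some (State nx r (updN n a 0))
  | Some (NSucc a) => Some (State nx r (updN n a (S (n a))))
  | Some (NPred a) => Some (State nx r (updN n a (Nat.pred (n a))))
  | Some (NLoad a b) => Some (State nx r (updN n a (n (n b))))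
  | Some (NStore a b) => Some (State nx r (updN n (n a) (n b)))
  | Some (JmpRLt i j t) =>
      Some (State (if Rlt_dec (r i) (r j) then t else nx) r n)
  | Some (JmpNZero a t) =>
      Some (State (if Nat.eqb (n a) 0 then t else nx) r n)
  | Some (Jmp t) => Some (State t r n)
  end.

Fixpoint run (P : program) (t : nat) (s : state) : option state :=
  match step P s with
  | None => Some s
  | Some s' => match t with O => None | S t' => run P t' s' end
  end.

(* Input encoding.
   Real memory: R[0] = g; for the t-th tree (0-indexed):
     R[3t+1] = threshold, R[3t+2] = yes value, R[3t+3] = no value;
   all other real registers are 0.
   Nat memory: N[0] = d, N[1] = m (number of trees), N[2+t] = feature of
   tree t, N[2+m+f] = (1 if f in F else 0) for f < d; all others 0. *)
Definition enc_rmem (I : instance) : nat -> R :=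
  fun j =>
    match j with
    | O => inst_g I
    | S j' =>
        let t := Nat.div j' 3 in
        let o := Nat.modulo j' 3 in
        match nth_error (inst_trees I) t with
        | None => 0
        | Some s => if Nat.eqb o 0 then st_thr s
                    else if Nat.eqb o 1 then st_yes s else st_no s
        end
    end.

Definition enc_nmem (I : instance) : nat -> nat :=
  let m := length (inst_trees I) in
  let d := inst_d I in
  fun j =>
    if Nat.eqb j 0 then d
    else if Nat.eqb j 1 then m
    else if Nat.ltb j (2 + m) then
      match nth_error (inst_trees I) (j - 2) with
      | Some s => st_feat s | None => O end
    else if Nat.ltb j (2 + m + d) then
      (if inst_F I (j - 2 - m) then 1 else 0)%nat
    else O.

Definition init_state (I : instance) : state :=
  State 0 (enc_rmem I) (enc_nmem I).

Definition output (s : state) : bool := negb (Nat.eqb (nmem s 0) 0).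

(* Main.v *)
(** For stumps the raw output is a sum over features of functions of a single
    coordinate, each a step function that only matters at the thresholds and at
    one value [low] below all of them.  The free features can therefore be
    optimised one by one, while the at most k fixed features are handled by
    trying all k-tuples of trees (f, tau), read as assignments x_f := tau over
    the default [low].  Both tests on the probabilities are monotone in the raw
    output, so only its extreme values matter.

    The input fills all low addresses of the machine, so no register is free at
    the start.  Moving the no-value of tree 0 into both values of tree 1 does not
    change the ensemble and frees one real register.  While it collects 2^d, the
    number d is added to m, which gives the address of a free memory area; after
    the input has been moved there, d is decoded from 2^d. *)

Require Import Defs.
From Stdlib Require Import Reals Lra Lia List Arith FunctionalExtensionality.
Import ListNotations.
Open Scope R_scope.

(** * A structured language compiled to the RAM *)

(** A program is one finite text, so it names only finitely many registers, and a long input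
    occupies all of them: the first instructions must make room without losing data. Adding [d] to
    [m] by a loop consumes the counter that holds [d], so [d] has to be recorded elsewhere. The one
    freed real register cannot count by units, because there is no second register to hold the unit;
    doubling needs no other operand, hence [2 ^ d]. Put [s = m + d]. The natural-number input has
    [s + 2] cells and the real input at most [3 * s + 1], so shifts by [s + K] and [3 * s + K] carry
    the input past itself and past all registers named in the text. The choice [K = 50 + 4 * k]
    leaves four real registers, from address 40 on, for each of the [k] nested loops of the
    enumeration. The exponent of the time bound comes from these nested loops and so depends on
    [k]. *)

Inductive cmd :=
| Skip
| Op (i : instr)
| Seq (c1 c2 : cmd)
| IfLt (i j : nat) (c1 c2 : cmd)
| IfZ (a : nat) (c1 c2 : cmd)
| Loop (a : nat) (c : cmd).

Notation "c1 ;; c2" := (Seq c1 c2) (at level 80, right associativity).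

Definition effect (i : instr) (r : nat -> R) (n : nat -> nat)
  : option ((nat -> R) * (nat -> nat)) :=
  match i with
  | RZero i => Some (updR r i 0, n)
  | ROne i => Some (updR r i 1, n)
  | RAdd i j l => Some (updR r i (r j + r l), n)
  | RSub i j l => Some (updR r i (r j - r l), n)
  | RMul i j l => Some (updR r i (r j * r l), n)
  | RExp i j => Some (updR r i (exp (r j)), n)
  | RLoad i a => Some (updR r i (r (n a)), n)
  | RStore a i => Some (updR r (n a) (r i), n)
  | NZero a => Some (r, updN n a 0)
  | NSucc a => Some (r, updN n a (S (n a)))
  | NPred a => Some (r, updN n a (Nat.pred (n a)))
  | NLoad a b => Some (r, updN n a (n (n b)))
  | NStore a b => Some (r, updN n (n a) (n b))
  | _ => None
  end.

Fixpoint len (c : cmd) : nat :=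
  match c with
  | Skip => 0
  | Op _ => 1
  | Seq c1 c2 => len c1 + len c2
  | IfLt _ _ c1 c2 | IfZ _ c1 c2 => S (len c2 + S (len c1))
  | Loop _ c => S (S (len c + 1))
  end.

(** Jump targets are absolute, so the code depends on the address [p] where it is placed. The branch
    for a failed test comes first because the machine falls through on failure; [JmpNZero] jumps on
    zero and thus serves as the loop exit. *)
Fixpoint compile (c : cmd) (p : nat) : list instr :=
  match c with
  | Skip => []
  | Op i => [i]
  | Seq c1 c2 => compile c1 p ++ compile c2 (p + len c1)
  | IfLt i j c1 c2 =>
      JmpRLt i j (p + 2 + len c2) :: compile c2 (p + 1)
        ++ Jmp (p + 2 + len c2 + len c1) :: compile c1 (p + 2 + len c2)
  | IfZ a c1 c2 =>
      JmpNZero a (p + 2 + len c2) :: compile c2 (p + 1)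
        ++ Jmp (p + 2 + len c2 + len c1) :: compile c1 (p + 2 + len c2)
  | Loop a c =>
      JmpNZero a (p + 3 + len c) :: NPred a :: compile c (p + 2) ++ [Jmp p]
  end.

(* The running time is not tracked: it suffices that every loop counter is at
   most [B] on entry, since then [cost B c] bounds the number of steps. *)
Fixpoint wp (B : nat) (c : cmd) (Q : (nat -> R) -> (nat -> nat) -> Prop)
  (r : nat -> R) (n : nat -> nat) : Prop :=
  match c with
  | Skip => Q r n
  | Op i => match effect i r n with Some (r', n') => Q r' n' | None => False end
  | Seq c1 c2 => wp B c1 (wp B c2 Q) r n
  | IfLt i j c1 c2 =>
      (r i < r j -> wp B c1 Q r n) /\ (~ r i < r j -> wp B c2 Q r n)
  | IfZ a c1 c2 =>
      (n a = 0%nat -> wp B c1 Q r n) /\ (n a <> 0%nat -> wp B c2 Q r n)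
  | Loop a c =>
      exists I : nat -> (nat -> R) -> (nat -> nat) -> Prop,
        (n a <= B)%nat /\ I (n a) r n /\
        (forall j r n, I (S j) r n -> n a = S j ->
           wp B c (fun r' n' => n' a = j /\ I j r' n') r (updN n a j)) /\
        (forall r n, I 0%nat r n -> n a = 0%nat -> Q r n)
  end.

(** Each round of a loop adds three steps, namely the test, the decrement and the jump back; the
    final [1] is the test that leaves the loop. Both branches of a conditional are charged. *)
Fixpoint cost (B : nat) (c : cmd) : nat :=
  match c with
  | Skip => 0
  | Op _ => 1
  | Seq c1 c2 => cost B c1 + cost B c2
  | IfLt _ _ c1 c2 | IfZ _ c1 c2 => 2 + cost B c1 + cost B c2
  | Loop _ c => B * (cost B c + 3) + 1
  end.

Lemma len_compile c p : length (compile c p) = len c.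
Proof.
  revert p; induction c; intros p; simpl; repeat rewrite ?length_app, ?IHc1, ?IHc2, ?IHc;
    simpl; rewrite ?IHc1, ?IHc2, ?IHc; lia.
Qed.

(** Every level of loop nesting raises the exponent by one. The base [B + 1] is at least 1, so
    exponents can be increased freely when two bounds are added. *)
Lemma cost_poly c : exists C e : nat, forall B : nat, (cost B c <= C * (B + 1) ^ e)%nat.
Proof.
  assert (mono : forall C e1 e2 B : nat, (e1 <= e2)%nat ->
            (C * (B + 1) ^ e1 <= C * (B + 1) ^ e2)%nat).
  { intros. apply Nat.mul_le_mono_l. apply Nat.pow_le_mono_r; lia. }
  assert (one : forall B e : nat, (1 <= (B + 1) ^ e)%nat).
  { intros. pose proof (Nat.pow_nonzero (B + 1) e). lia. }
  assert (two : forall k c1 c2 : cmd, (exists C e : nat, forall B : nat, (cost B c1 <= C * (B + 1) ^ e)%nat) ->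
     (exists C e : nat, forall B : nat, (cost B c2 <= C * (B + 1) ^ e)%nat) ->
     exists C e : nat, forall B : nat, (2 + cost B c1 + cost B c2 <= C * (B + 1) ^ e)%nat).
  { intros _ c1 c2 (C1 & e1 & H1) (C2 & e2 & H2). exists (2 + C1 + C2)%nat, (e1 + e2)%nat.
    intros B. specialize (H1 B); specialize (H2 B).
    pose proof (mono C1 e1 (e1 + e2)%nat B ltac:(lia)).
    pose proof (mono C2 e2 (e1 + e2)%nat B ltac:(lia)).
    pose proof (one B (e1 + e2)%nat). nia. }
  induction c; simpl.
  - exists 0%nat, 0%nat; intros; lia.
  - exists 1%nat, 0%nat; intros; simpl; lia.
  - destruct (two Skip _ _ IHc1 IHc2) as (C & e & H). exists C, e. intros B. specialize (H B); lia.
  - apply (two Skip); assumption.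
  - apply (two Skip); assumption.
  - destruct IHc as (C & e & H). exists (C + 4)%nat, (e + 1)%nat. intros B. specialize (H B).
    rewrite Nat.pow_add_r, Nat.pow_1_r. pose proof (one B e). nia.
Qed.

(** * Execution of compiled code *)

Inductive steps (P : program) : nat -> state -> state -> Prop :=
| steps_O s : steps P 0 s s
| steps_S t s s' s'' : step P s = Some s' -> steps P t s' s'' -> steps P (S t) s s''.

Lemma steps_trans P t1 t2 s1 s2 s3 :
  steps P t1 s1 s2 -> steps P t2 s2 s3 -> steps P (t1 + t2) s1 s3.
Proof. induction 1; simpl; eauto using steps. Qed.

Lemma steps_run P t s s' u :
  steps P t s s' -> step P s' = None -> (t <= u)%nat -> run P u s = Some s'.
Proof.
  intros H; revert u; induction H; intros u Hn Hu.
  - destruct u; simpl; rewrite Hn; reflexivity.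
  - destruct u; [lia|]. simpl. rewrite H. apply IHsteps; auto; lia.
Qed.

Definition code_at (P : program) (p : nat) (l : list instr) : Prop :=
  exists A Z, P = A ++ l ++ Z /\ length A = p.

Lemma code_at_app P p l1 l2 :
  code_at P p (l1 ++ l2) -> code_at P p l1 /\ code_at P (p + length l1) l2.
Proof.
  intros (A & Z & -> & <-). split.
  - exists A, (l2 ++ Z). rewrite <- app_assoc. auto.
  - exists (A ++ l1), Z. rewrite <- !app_assoc, length_app. auto.
Qed.

Lemma code_at_cons P p i l :
  code_at P p (i :: l) -> nth_error P p = Some i /\ code_at P (p + 1) l.
Proof.
  intros H. change (i :: l) with ([i] ++ l) in H. apply code_at_app in H.
  destruct H as [(A & Z & -> & <-) H2]. split; [|exact H2].
  rewrite nth_error_app2, Nat.sub_diag by lia. reflexivity.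
Qed.

Lemma step_effect P p r n i r' n' :
  nth_error P p = Some i -> effect i r n = Some (r', n') ->
  step P (State p r n) = Some (State (S p) r' n').
Proof.
  intros H1 H2. unfold step. simpl. rewrite H1.
  destruct i; simpl in H2; inversion H2; reflexivity.
Qed.

Lemma wp_sound B c : forall Q r n P p,
  code_at P p (compile c p) -> wp B c Q r n ->
  exists t r' n', Q r' n' /\ (t <= cost B c)%nat /\
    steps P t (State p r n) (State (p + len c) r' n').
Proof.
  induction c as [|i|c1 IH1 c2 IH2|i j c1 IH1 c2 IH2|a c1 IH1 c2 IH2|a c IH];
    intros Q r n P p Hc Hw; simpl in Hc, Hw |- *.
  - exists 0%nat, r, n. rewrite Nat.add_0_r. repeat split; [assumption|lia|constructor].
  - apply code_at_cons in Hc. destruct Hc as [Hc _].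
    destruct (effect i r n) as [[r' n']|] eqn:E; [|contradiction].
    exists 1%nat, r', n'. repeat split; [assumption|lia|].
    rewrite Nat.add_1_r. econstructor; [|constructor]. eapply step_effect; eauto.
  - apply code_at_app in Hc. rewrite len_compile in Hc. destruct Hc as [Hc1 Hc2].
    destruct (IH1 _ _ _ _ _ Hc1 Hw) as (t1 & r1 & n1 & Hw1 & Ht1 & Hs1).
    destruct (IH2 _ _ _ _ _ Hc2 Hw1) as (t2 & r2 & n2 & Hw2 & Ht2 & Hs2).
    exists (t1 + t2)%nat, r2, n2. repeat split; [assumption|lia|].
    rewrite Nat.add_assoc. eapply steps_trans; eauto.
  - apply code_at_cons in Hc. destruct Hc as [Hj Hc].
    apply code_at_app in Hc. rewrite len_compile in Hc. destruct Hc as [Hc2 Hc].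
    apply code_at_cons in Hc. destruct Hc as [He Hc1].
    replace (p + 1 + len c2 + 1)%nat with (p + 2 + len c2)%nat in Hc1 by lia.
    destruct (Rlt_dec (r i) (r j)) as [Hlt|Hlt].
    + destruct (IH1 _ _ _ _ _ Hc1 (proj1 Hw Hlt)) as (t & r' & n' & Hw' & Ht & Hs).
      exists (S t), r', n'. repeat split; [assumption|lia|].
      econstructor; [unfold step; simpl; rewrite Hj; reflexivity|].
      destruct (Rlt_dec (r i) (r j)); [|contradiction].
      replace (p + S (len c2 + S (len c1)))%nat with (p + 2 + len c2 + len c1)%nat by lia.
      assumption.
    + destruct (IH2 _ _ _ _ _ Hc2 (proj2 Hw Hlt)) as (t & r' & n' & Hw' & Ht & Hs).
      exists (S (t + 1)), r', n'. repeat split; [assumption|lia|].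
      econstructor; [unfold step; simpl; rewrite Hj; reflexivity|].
      destruct (Rlt_dec (r i) (r j)); [contradiction|].
      replace (S p) with (p + 1)%nat by lia. eapply steps_trans; [exact Hs|].
      econstructor; [unfold step; simpl; rewrite He; reflexivity|]. simpl.
      replace (p + S (len c2 + S (len c1)))%nat with (p + 2 + len c2 + len c1)%nat by lia.
      constructor.
  - apply code_at_cons in Hc. destruct Hc as [Hj Hc].
    apply code_at_app in Hc. rewrite len_compile in Hc. destruct Hc as [Hc2 Hc].
    apply code_at_cons in Hc. destruct Hc as [He Hc1].
    replace (p + 1 + len c2 + 1)%nat with (p + 2 + len c2)%nat in Hc1 by lia.
    destruct (Nat.eqb_spec (n a) 0) as [Hz|Hz].
    + destruct (IH1 _ _ _ _ _ Hc1 (proj1 Hw Hz)) as (t & r' & n' & Hw' & Ht & Hs).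
      exists (S t), r', n'. repeat split; [assumption|lia|].
      econstructor; [unfold step; simpl; rewrite Hj, Hz; reflexivity|].
      replace (p + S (len c2 + S (len c1)))%nat with (p + 2 + len c2 + len c1)%nat by lia.
      assumption.
    + destruct (IH2 _ _ _ _ _ Hc2 (proj2 Hw Hz)) as (t & r' & n' & Hw' & Ht & Hs).
      exists (S (t + 1)), r', n'. repeat split; [assumption|lia|].
      econstructor; [unfold step; simpl; rewrite Hj, (proj2 (Nat.eqb_neq _ _) Hz); reflexivity|].
      replace (S p) with (p + 1)%nat by lia. eapply steps_trans; [exact Hs|].
      econstructor; [unfold step; simpl; rewrite He; reflexivity|]. simpl.
      replace (p + S (len c2 + S (len c1)))%nat with (p + 2 + len c2 + len c1)%nat by lia.
      constructor.
  - apply code_at_cons in Hc. destruct Hc as [Hj Hc].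
    apply code_at_cons in Hc. destruct Hc as [Hp Hc].
    replace (p + 1 + 1)%nat with (p + 2)%nat in Hc by lia.
    apply code_at_app in Hc. rewrite len_compile in Hc. destruct Hc as [Hc Hb].
    apply code_at_cons in Hb. destruct Hb as [Hb _].
    destruct Hw as (I & HB & HI & Hbody & Hexit).
    (* Induction on the current counter value, with the state generalised; [B] replaces the number
       of rounds only at the very end. *)
    assert (forall j r n, n a = j -> I j r n ->
      exists t r' n', Q r' n' /\ (t <= j * (cost B c + 3) + 1)%nat /\
        steps P t (State p r n) (State (p + S (S (len c + 1))) r' n')) as Hgo.
    { clear r n HB HI. induction j as [|j IHj]; intros r n Hn HI.
      - exists 1%nat, r, n. repeat split; [auto|lia|].
        econstructor; [unfold step; simpl; rewrite Hj, Hn; reflexivity|]. simpl.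
        replace (p + S (S (len c + 1)))%nat with (p + 3 + len c)%nat by lia. constructor.
      - specialize (Hbody j r n HI Hn).
        destruct (IH _ _ _ _ _ Hc Hbody) as (t & r' & n' & [Hn' HI'] & Ht & Hs).
        destruct (IHj r' n' Hn' HI') as (t' & r'' & n'' & HQ & Ht' & Hs').
        exists (S (S (t + S t'))), r'', n''. repeat split; [assumption|lia|].
        econstructor; [unfold step; simpl; rewrite Hj, Hn; reflexivity|]. simpl.
        replace (S p) with (p + 1)%nat by lia.
        econstructor; [unfold step; simpl; rewrite Hp, Hn; reflexivity|]. simpl.
        replace (S (p + 1)) with (p + 2)%nat by lia.
        eapply steps_trans; [exact Hs|].
        econstructor; [unfold step; simpl; rewrite Hb; reflexivity|]. exact Hs'. }
    destruct (Hgo _ r n eq_refl HI) as (t & r' & n' & HQ & Ht & Hs).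
    exists t, r', n'. repeat split; [assumption| |assumption].
    eapply Nat.le_trans; [exact Ht|]. nia.
Qed.

Lemma wp_mono B c : forall (Q Q' : (nat -> R) -> (nat -> nat) -> Prop) r n,
  wp B c Q r n -> (forall r n, Q r n -> Q' r n) -> wp B c Q' r n.
Proof.
  induction c; intros Q Q' r n H HQ; simpl in *; eauto.
  - destruct (effect i r n) as [[r' n']|]; auto.
  - destruct H; split; eauto.
  - destruct H; split; eauto.
  - destruct H as (I & H1 & H2 & H3 & H4). exists I. repeat split; eauto.
Qed.

(** * Syntactic frame conditions *)

Fixpoint wrR (c : cmd) (i : nat) : Prop :=
  match c with
  | Op (RZero j) | Op (ROne j) | Op (RAdd j _ _) | Op (RSub j _ _)
  | Op (RMul j _ _) | Op (RExp j _) | Op (RLoad j _) => i = j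
  | Op (RStore _ _) => True
  | Skip | Op _ => False
  | Seq c1 c2 | IfLt _ _ c1 c2 | IfZ _ c1 c2 => wrR c1 i \/ wrR c2 i
  | Loop _ c => wrR c i
  end.

Fixpoint wrN (c : cmd) (a : nat) : Prop :=
  match c with
  | Op (NZero b) | Op (NSucc b) | Op (NPred b) | Op (NLoad b _) => a = b
  | Op (NStore _ _) => True
  | Skip | Op _ => False
  | Seq c1 c2 | IfLt _ _ c1 c2 | IfZ _ c1 c2 => wrN c1 a \/ wrN c2 a
  | Loop b c => a = b \/ wrN c a
  end.

Lemma updR_eq m i v : updR m i v i = v.
Proof. unfold updR. rewrite Nat.eqb_refl. reflexivity. Qed.

Lemma updR_ne m i v j : j <> i -> updR m i v j = m j.
Proof. intros H. unfold updR. rewrite (proj2 (Nat.eqb_neq _ _) H). reflexivity. Qed.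

Lemma updN_eq m i v : updN m i v i = v.
Proof. unfold updN. rewrite Nat.eqb_refl. reflexivity. Qed.

Lemma updN_ne m i v j : j <> i -> updN m i v j = m j.
Proof. intros H. unfold updN. rewrite (proj2 (Nat.eqb_neq _ _) H). reflexivity. Qed.

(** A specification can thus speak only of what a command computes; what it leaves alone is read off
    its text. Indirect stores count as writing everywhere, so code that uses them states its frame
    explicitly. *)
Lemma wp_frame B c : forall Q r n,
  wp B c Q r n ->
  wp B c (fun r' n' => Q r' n' /\ (forall i, ~ wrR c i -> r' i = r i) /\
                       (forall a, ~ wrN c a -> n' a = n a)) r n.
Proof.
  induction c as [|i|c1 IH1 c2 IH2|i j c1 IH1 c2 IH2|a c1 IH1 c2 IH2|a c IH];
    intros Q r n H; simpl in *.
  - auto.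
  - destruct i; simpl in *; try contradiction;
      (split; [assumption|]); split; intros; rewrite ?updR_ne, ?updN_ne by tauto;
      try reflexivity; tauto.
  - apply IH1 in H. eapply wp_mono; [exact H|]. cbv beta. intros r1 n1 (H1 & Hr & Hn).
    apply IH2 in H1. eapply wp_mono; [exact H1|]. cbv beta. intros r2 n2 (H2 & Hr2 & Hn2).
    split; [assumption|]. split; intros; [rewrite Hr2, Hr|rewrite Hn2, Hn]; tauto.
  - destruct H as [H1 H2]. split; intros Hl;
      [specialize (H1 Hl); apply IH1 in H1; eapply wp_mono; [exact H1|]
      |specialize (H2 Hl); apply IH2 in H2; eapply wp_mono; [exact H2|]];
      cbv beta; intros r1 n1 (HQ & Hr & Hn); split; auto; split; intros; [apply Hr|apply Hn|apply Hr|apply Hn]; tauto.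
  - destruct H as [H1 H2]. split; intros Hl;
      [specialize (H1 Hl); apply IH1 in H1; eapply wp_mono; [exact H1|]
      |specialize (H2 Hl); apply IH2 in H2; eapply wp_mono; [exact H2|]];
      cbv beta; intros r1 n1 (HQ & Hr & Hn); split; auto; split; intros; [apply Hr|apply Hn|apply Hr|apply Hn]; tauto.
  - destruct H as (I & H1 & H2 & H3 & H4).
    exists (fun j r' n' => I j r' n' /\ (forall i, ~ wrR c i -> r' i = r i) /\
                       (forall b, ~ (b = a \/ wrN c b) -> n' b = n b)).
    split; [assumption|]. split; [auto|]. split.
    + intros j r1 n1 (HI & Hr & Hn) Ha. specialize (H3 j r1 n1 HI Ha). apply IH in H3.
      eapply wp_mono; [exact H3|]. cbv beta. intros r2 n2 ((Ha2 & HI2) & Hr2 & Hn2).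
      split; [assumption|]. split; [assumption|].
      split; intros; [rewrite Hr2, Hr|rewrite Hn2, updN_ne, Hn]; tauto.
    + intros r1 n1 (HI & Hr & Hn) Ha. auto.
Qed.

Lemma wp_use B c (Q Q' : (nat -> R) -> (nat -> nat) -> Prop) r n :
  wp B c Q r n ->
  (forall r' n', Q r' n' -> (forall i, ~ wrR c i -> r' i = r i) ->
                 (forall a, ~ wrN c a -> n' a = n a) -> Q' r' n') ->
  wp B c Q' r n.
Proof.
  intros H HQ. apply wp_frame in H. eapply wp_mono; [exact H|].
  cbv beta. intros r' n' (? & ? & ?). auto.
Qed.

(** * Constants and moves in natural-number registers *)

Fixpoint iter_cmd (c : cmd) (j : nat) : cmd :=
  match j with O => Skip | S j => c ;; iter_cmd c j end.

Lemma wp_NSuccs B a j : forall Q r n,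
  Q r (updN n a (n a + j)%nat) -> wp B (iter_cmd (Op (NSucc a)) j) Q r n.
Proof.
  induction j as [|j IH]; intros Q r n H; simpl.
  - replace (updN n a (n a + 0)%nat) with n in H; [assumption|].
    apply functional_extensionality; intros i. unfold updN.
    destruct (Nat.eqb_spec i a); subst; lia.
  - apply IH. rewrite updN_eq.
    replace (updN (updN n a (S (n a))) a (S (n a) + j)%nat) with (updN n a (n a + S j)%nat);
      [assumption|].
    apply functional_extensionality; intros i. unfold updN.
    destruct (Nat.eqb_spec i a); subst; lia.
Qed.

Lemma wp_NPreds B a j : forall Q r n,
  Q r (updN n a (n a - j)%nat) -> wp B (iter_cmd (Op (NPred a)) j) Q r n.
Proof.
  induction j as [|j IH]; intros Q r n H; simpl.
  - replace (updN n a (n a - 0)%nat) with n in H; [assumption|].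
    apply functional_extensionality; intros i. unfold updN.
    destruct (Nat.eqb_spec i a); subst; lia.
  - apply IH. rewrite updN_eq.
    replace (updN (updN n a (Nat.pred (n a))) a (Nat.pred (n a) - j)%nat)
      with (updN n a (n a - S j)%nat); [assumption|].
    apply functional_extensionality; intros i. unfold updN.
    destruct (Nat.eqb_spec i a); subst; lia.
Qed.

Definition NConst (a v : nat) : cmd := Op (NZero a) ;; iter_cmd (Op (NSucc a)) v.

Lemma wp_NConst B a v Q r n : Q r (updN n a v) -> wp B (NConst a v) Q r n.
Proof.
  intros H. simpl. apply wp_NSuccs. rewrite updN_eq.
  replace (updN (updN n a 0) a (0 + v)%nat) with (updN n a v); [assumption|].
  apply functional_extensionality; intros i. unfold updN.
  destruct (Nat.eqb_spec i a); subst; lia.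
Qed.

(* There is no direct move between registers: load through the address [b]. *)
Definition Mov (a b : nat) : cmd := NConst a b ;; Op (NLoad a a).

Lemma wp_Mov B a b Q r n : a <> b -> Q r (updN n a (n b)) -> wp B (Mov a b) Q r n.
Proof.
  intros Hab H. unfold Mov. cbn [wp]. apply wp_NConst. cbn. rewrite updN_eq, updN_ne by auto.
  replace (updN (updN n a b) a (n b)) with (updN n a (n b)); [assumption|].
  apply functional_extensionality; intros i. unfold updN.
  destruct (Nat.eqb_spec i a); subst; lia.
Qed.

Lemma wr_iter c j : (forall i, wrR (iter_cmd c j) i -> wrR c i) /\
                    (forall i, wrN (iter_cmd c j) i -> wrN c i).
Proof. induction j as [|j [IH1 IH2]]; simpl; split; firstorder. Qed.

Lemma wrR_Mov a b i : wrR (Mov a b) i -> False.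
Proof. simpl. intros [[[]|H]|[]]. apply wr_iter in H. exact H. Qed.

Lemma wrN_Mov a b i : wrN (Mov a b) i -> i = a.
Proof. simpl. intros [[H|H]|H]; auto. apply wr_iter in H. exact H. Qed.

(** * Loops over a table of records *)

(** The feature becomes a real code, so that a whole record lies in real memory and the
    natural-number registers are left to counters and pointers. *)
Record rcd := Rcd { rc : R; rt : R; ry : R; rn : R }.

Definition recs_at (r : nat -> R) (G : nat) (L : list rcd) : Prop :=
  forall i x, nth_error L i = Some x ->
    r (G + 4 * i)%nat = rc x /\ r (G + 4 * i + 1)%nat = rt x /\
    r (G + 4 * i + 2)%nat = ry x /\ r (G + 4 * i + 3)%nat = rn x.

Definition ready (G : nat) (L : list rcd) (r : nat -> R) (n : nat -> nat) : Prop :=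
  n 1%nat = length L /\ n 2%nat = G /\ recs_at r G L.

(** The body finds the current record in the four real registers from [b] on. Counter, pointer and
    [b] are parameters so that such loops can be nested. *)
Definition for_recs (cn pn b : nat) (body : cmd) : cmd :=
  Mov cn 1 ;; Mov pn 2 ;;
  Loop cn
    (Op (RLoad b pn) ;; Op (NSucc pn) ;; Op (RLoad (b + 1) pn) ;; Op (NSucc pn) ;;
     Op (RLoad (b + 2) pn) ;; Op (NSucc pn) ;; Op (RLoad (b + 3) pn) ;; Op (NSucc pn) ;;
     body).

Ltac upd := repeat match goal with
  | |- context [updR ?m ?i ?v ?i] => rewrite (updR_eq m i v)
  | |- context [updN ?m ?i ?v ?i] => rewrite (updN_eq m i v)
  | |- context [updR ?m ?i ?v ?j] => rewrite (updR_ne m i v j) by lia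
  | |- context [updN ?m ?i ?v ?j] => rewrite (updN_ne m i v j) by lia
  end.

Lemma ready_frame K G L r n r' n' :
  ready G L r n -> (K <= G)%nat -> (forall i, (K <= i)%nat -> r' i = r i) ->
  n' 1%nat = n 1%nat -> n' 2%nat = n 2%nat -> ready G L r' n'.
Proof.
  intros (H1 & H2 & H3) HK Hr Hn1 Hn2. repeat split; try congruence;
    apply H3 in H; rewrite Hr by lia; tauto.
Qed.

(** The invariant is indexed by the records already visited. It must be insensitive to the registers
    that the loop itself overwrites between rounds. The bound [K] separates what the body may write
    from the table, so the table survives. *)
Lemma wp_for_recs B K G L cn pn b body (I : list rcd -> (nat -> R) -> (nat -> nat) -> Prop)
  (Q : (nat -> R) -> (nat -> nat) -> Prop) r n :
  (2 < cn /\ 2 < pn /\ cn <> pn /\ b + 3 < K /\ K <= G /\ length L <= B)%nat ->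
  (forall i, wrR body i -> (i < K)%nat) ->
  (~ wrN body 1 /\ ~ wrN body 2 /\ ~ wrN body cn /\ ~ wrN body pn) ->
  ready G L r n ->
  (forall p r1 n1 r2 n2, I p r1 n1 ->
     (forall i, ~ (b <= i <= b + 3)%nat -> r2 i = r1 i) ->
     (forall a, a <> cn -> a <> pn -> n2 a = n1 a) -> I p r2 n2) ->
  I [] r n ->
  (forall p x s r' n', L = p ++ x :: s -> I p r' n' -> ready G L r' n' ->
     r' b = rc x -> r' (b + 1)%nat = rt x -> r' (b + 2)%nat = ry x -> r' (b + 3)%nat = rn x ->
     (forall i, ~ (b <= i <= b + 3)%nat -> ~ wrR body i -> r' i = r i) ->
     (forall a, a <> cn -> a <> pn -> ~ wrN body a -> n' a = n a) ->
     wp B body (I (p ++ [x])) r' n') ->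
  (forall r' n', I L r' n' -> ready G L r' n' ->
     (forall i, ~ (b <= i <= b + 3)%nat -> ~ wrR body i -> r' i = r i) ->
     (forall a, a <> cn -> a <> pn -> ~ wrN body a -> n' a = n a) -> Q r' n') ->
  wp B (for_recs cn pn b body) Q r n.
Proof.
  intros Hc HwR HwN Hr Hst H0 Hstep Hend. unfold for_recs.
  cbn [wp]. apply wp_Mov; [lia|]. apply wp_Mov; [lia|].
  destruct Hr as (Hm & HG & Hrec).
  exists (fun j r' n' => exists p s, L = p ++ s /\ length s = j /\
    n' pn = (G + 4 * length p)%nat /\ I p r' n' /\
    (forall i, ~ (b <= i <= b + 3)%nat -> ~ wrR body i -> r' i = r i) /\
    (forall a, a <> cn -> a <> pn -> ~ wrN body a -> n' a = n a)).
  assert (Hrdy : forall r' n',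
    (forall i, ~ (b <= i <= b + 3)%nat -> ~ wrR body i -> r' i = r i) ->
    (forall a, a <> cn -> a <> pn -> ~ wrN body a -> n' a = n a) -> ready G L r' n').
  { intros r' n' Hr Hn. apply (ready_frame K G L r n); [repeat split; try assumption; apply Hrec; assumption|lia| | |].
    - intros i Hi. apply Hr; [lia|]. intros Hw. apply HwR in Hw. lia.
    - apply Hn; [lia|lia|tauto].
    - apply Hn; [lia|lia|tauto]. }
  split; [upd; lia|]. split; [|split].
  - exists [], L. upd. repeat split; simpl; try lia.
    + eapply Hst; [exact H0|auto|]. intros; upd; reflexivity.
    + intros; upd; reflexivity.
  - intros j r1 n1 (p & s & HL & Hs & Hp & HI & HfR & HfN) Hj.
    destruct s as [|x s]; [discriminate|]. cbn [wp effect].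
    rewrite !updN_eq. upd.
    destruct (Hrdy _ _ HfR HfN) as (_ & _ & Hrec1).
    destruct (Hrec1 (length p) x) as (E1 & E2 & E3 & E4).
    { rewrite HL, nth_error_app2, Nat.sub_diag by lia. reflexivity. }
    match goal with |- wp _ _ _ ?rr ?nn => set (r2 := rr); set (n2 := nn) end.
    assert (Hr2 : forall i, ~ (b <= i <= b + 3)%nat -> r2 i = r1 i)
      by (intros; unfold r2; upd; reflexivity).
    assert (Hn2 : forall a, a <> cn -> a <> pn -> n2 a = n1 a)
      by (intros; unfold n2; upd; reflexivity).
    assert (Hn2c : n2 cn = j) by (unfold n2; upd; reflexivity).
    assert (Hn2p : n2 pn = (G + 4 * length p + 4)%nat) by (unfold n2; upd; lia).
    assert (Hb0 : r2 b = rc x) by (unfold r2; upd; rewrite Hp; assumption).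
    assert (Hb1 : r2 (b + 1)%nat = rt x) by (unfold r2; upd; rewrite Hp, <- Nat.add_1_r; assumption).
    assert (Hb2 : r2 (b + 2)%nat = ry x).
    { unfold r2; upd; rewrite Hp. rewrite <- E3. f_equal. lia. }
    assert (Hb3 : r2 (b + 3)%nat = rn x).
    { unfold r2; upd; rewrite Hp. rewrite <- E4. f_equal. lia. }
    clearbody r2 n2.
    assert (HfR2 : forall i, ~ (b <= i <= b + 3)%nat -> ~ wrR body i -> r2 i = r i)
      by (intros; rewrite Hr2; auto).
    assert (HfN2 : forall a, a <> cn -> a <> pn -> ~ wrN body a -> n2 a = n a)
      by (intros; rewrite Hn2; auto).
    eapply wp_use.
    + apply (Hstep p x s r2 n2); auto. eapply Hst; eauto.
    + cbv beta. intros r3 n3 HI3 Hr3 Hn3. split; [rewrite Hn3; tauto|].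
      exists (p ++ [x]), s. split; [rewrite HL, <- app_assoc; reflexivity|].
      split; [simpl in Hs; lia|]. rewrite length_app. simpl.
      split; [rewrite Hn3, Hn2p by tauto; lia|]. split; [assumption|].
      split; intros; [rewrite Hr3|rewrite Hn3]; auto.
  - intros r' n' (p & s & HL & Hs & Hp & HI & HfR & HfN) _.
    destruct s; [|discriminate]. rewrite app_nil_r in HL. subst p. auto.
Qed.

Lemma wrR_for_recs cn pn b body i :
  wrR (for_recs cn pn b body) i -> (b <= i <= b + 3)%nat \/ wrR body i.
Proof.
  unfold for_recs. cbn [wrR]. intros [H|[H|H]]; [apply wrR_Mov in H; tauto..|].
  intuition lia.
Qed.

Lemma wrN_for_recs cn pn b body a :
  wrN (for_recs cn pn b body) a -> a = cn \/ a = pn \/ wrN body a.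
Proof.
  unfold for_recs. cbn [wrN]. intros [H|[H|H]]; [apply wrN_Mov in H; tauto..|].
  tauto.
Qed.

(** * The decision procedure on records *)

Definition sumf {A} (f : A -> R) (l : list A) : R := fold_right (fun x a => f x + a) 0 l.

Lemma sumf_app {A} (f : A -> R) l1 l2 : sumf f (l1 ++ l2) = sumf f l1 + sumf f l2.
Proof. unfold sumf. induction l1; simpl; lra. Qed.

Lemma sumf_snoc {A} (f : A -> R) l x : sumf f (l ++ [x]) = sumf f l + f x.
Proof. rewrite sumf_app. unfold sumf at 2. simpl. lra. Qed.

Definition ev (v : R) (x : rcd) : R := if Rlt_dec v (rt x) then ry x else rn x.

Definition part (L : list rcd) (c v : R) : R :=
  sumf (fun x => if Req_dec_T (rc x) c then ev v x else 0) L.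

(** Thresholds of other features take part as well. Every real is an admissible value of a
    coordinate, so additional candidates cannot exceed the true maximum. *)
Definition mx (L : list rcd) (low c : R) (l : list rcd) : R :=
  fold_left (fun a x => Rmax a (part L c (rt x))) l (part L c low).

Definition mn (L : list rcd) (low c : R) (l : list rcd) : R :=
  fold_left (fun a x => Rmin a (part L c (rt x))) l (part L c low).

(** The positive code [INR (S f)] belongs to a free feature [f]; in the table of an ensemble no
    record of a fixed feature has it, so fixed features contribute 0. *)
Definition hi (L : list rcd) (low : R) (d : nat) : R :=
  sumf (fun f => mx L low (INR (S f)) L) (seq 0 d).

Definition lo (L : list rcd) (low : R) (d : nat) : R :=
  sumf (fun f => mn L low (INR (S f)) L) (seq 0 d).

(** The first match wins, so a tuple that mentions a feature several times still denotes one
    assignment. *)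
Fixpoint look (low : R) (ov : list rcd) (c : R) : R :=
  match ov with
  | [] => low
  | x :: ov => if Req_dec_T (rc x) c then rt x else look low ov c
  end.

Definition fixpart (L : list rcd) (low : R) (ov : list rcd) : R :=
  sumf (fun x => if Rlt_dec (rc x) 0 then ev (look low ov (rc x)) x else 0) L.

(* The machine has no division, so [prob >= 1/2 + g] and [prob <= 1/2 - g] are
   tested with the denominator cleared. *)
Definition up_ok (g s : R) : Prop := (1 + g + g) * (exp (0 - s) + 1) <= 1 + 1.
Definition dn_ok (g s : R) : Prop := 1 + 1 <= (1 - g - g) * (exp (0 - s) + 1).

(** One tuple serves both tests, because the two inputs share the fixed features, while the free
    ones are maximised for the first input and minimised for the second. *)
Definition accept (L : list rcd) (low : R) (d : nat) (g : R) (ov : list rcd) : Prop :=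
  up_ok g (fixpart L low ov + hi L low d) /\ dn_ok g (fixpart L low ov + lo L low d).

Definition IfEq (i j : nat) (c : cmd) : cmd := IfLt i j Skip (IfLt j i Skip c).

Lemma wp_IfEq B i j c (Q : (nat -> R) -> (nat -> nat) -> Prop) r n :
  (r i = r j -> wp B c Q r n) -> (r i <> r j -> Q r n) -> wp B (IfEq i j c) Q r n.
Proof.
  intros H1 H2. cbn. split; intros Hlt; [apply H2; lra|].
  split; intros Hlt'; [apply H2; lra|]. apply H1; lra.
Qed.

(** The [0] is a register index: this is a move as long as real register 0 holds zero. *)
Definition mov_r (i j : nat) : cmd := Op (RAdd i j 0).

Definition eval_cmd (b : nat) : cmd :=
  IfLt 7 (b + 1) (Op (RAdd 8 8 (b + 2))) (Op (RAdd 8 8 (b + 3))).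

(* Real registers: 0 = zero, 1 = one, 2 = gap, 3 = low, 4 = hi, 5 = lo,
   6 = current code, 7 = current value, 8 = sum, 9 / 10 = running max / min. *)
Definition part_cmd : cmd :=
  Op (RZero 8) ;; for_recs 7 8 24 (IfEq 24 6 (eval_cmd 24)).

Ltac wr :=
  repeat match goal with H : wrR (for_recs _ _ _ _) _ |- _ => apply wrR_for_recs in H
  | H : wrN (for_recs _ _ _ _) _ |- _ => apply wrN_for_recs in H end;
  cbn in *; intuition (try lia).

Lemma wp_part B K G L Q r n :
  (30 <= K <= G /\ length L <= B)%nat -> ready G L r n ->
  (forall r' n', r' 8%nat = part L (r 6%nat) (r 7%nat) ->
     (forall i, i <> 8%nat -> ~ (24 <= i <= 27)%nat -> r' i = r i) ->
     (forall a, a <> 7%nat -> a <> 8%nat -> n' a = n a) -> ready G L r' n' -> Q r' n') ->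
  wp B part_cmd Q r n.
Proof.
  intros HK Hr HQ. unfold part_cmd. cbn [wp effect].
  eapply (wp_for_recs B K G L 7 8 24 _
    (fun p r' n' => r' 8%nat = part p (r 6%nat) (r 7%nat))); try lia.
  - cbn. intros; lia.
  - cbn. lia.
  - eapply ready_frame; [exact Hr|apply HK| | |]; intros; upd; reflexivity.
  - cbv beta. intros p r1 n1 r2 n2 H1 H2 H3. rewrite H2 by lia. exact H1.
  - reflexivity.
  - intros p x s r1 n1 HL HI Hrd E0 E1 E2 E3 Hfr Hfn. unfold part in *.
    assert (H6 : r1 6%nat = r 6%nat) by (rewrite Hfr by (cbn; lia); reflexivity).
    assert (H7 : r1 7%nat = r 7%nat) by (rewrite Hfr by (cbn; lia); reflexivity).
    rewrite sumf_snoc.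
    apply wp_IfEq; rewrite E0, H6; intros Heq; destruct (Req_dec_T (rc x) (r 6%nat)); try contradiction.
    + cbn in E1, E2, E3 |- *. unfold ev in *. rewrite E1, H7, E2, E3.
      destruct (Rlt_dec (r 7%nat) (rt x)); split; intros; try contradiction; upd; rewrite HI; lra.
    + rewrite HI. lra.
  - intros r1 n1 HI Hrd Hfr Hfn. apply HQ; auto.
    + intros i H8 H24. rewrite Hfr by (cbn; lia). upd; reflexivity.
    + intros. apply Hfn; auto. cbn. lia.
Qed.

Definition extrema_cmd : cmd :=
  mov_r 7 3 ;; part_cmd ;; mov_r 9 8 ;; mov_r 10 8 ;;
  for_recs 5 6 20
    (mov_r 7 21 ;; part_cmd ;; IfLt 9 8 (mov_r 9 8) Skip ;; IfLt 8 10 (mov_r 10 8) Skip).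

Lemma wr_part :
  (forall i, wrR part_cmd i -> i = 8%nat \/ (24 <= i <= 27)%nat) /\
  (forall a, wrN part_cmd a -> a = 7%nat \/ a = 8%nat).
Proof. unfold part_cmd. split; cbn [wrR wrN]; wr. Qed.

Lemma wp_extrema B K G L Q r n :
  (30 <= K <= G /\ length L <= B)%nat -> ready G L r n -> r 0%nat = 0 ->
  (forall r' n', r' 9%nat = mx L (r 3%nat) (r 6%nat) L ->
     r' 10%nat = mn L (r 3%nat) (r 6%nat) L ->
     (forall i, ~ (7 <= i <= 27)%nat -> r' i = r i) ->
     (forall a, ~ (5 <= a <= 8)%nat -> n' a = n a) -> ready G L r' n' -> Q r' n') ->
  wp B extrema_cmd Q r n.
Proof.
  intros HK Hr H0 HQ. unfold extrema_cmd. cbn [wp effect mov_r].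
  eapply (wp_part B K G L); [lia| |].
  { eapply ready_frame; [exact Hr|apply HK| | |]; intros; upd; reflexivity. }
  intros r1 n1 H8 Hfr Hfn Hrd. revert H8; upd; intros H8. rewrite H0, Rplus_0_r in H8.
  assert (Z1 : r1 0%nat = 0) by (rewrite Hfr by lia; upd; assumption).
  assert (Z6 : r1 6%nat = r 6%nat) by (rewrite Hfr by lia; upd; reflexivity).
  rewrite Z1, H8, Rplus_0_r.
  eapply (wp_for_recs B K G L 5 6 20 _
    (fun p r' n' => r' 9%nat = mx L (r 3%nat) (r 6%nat) p /\
                    r' 10%nat = mn L (r 3%nat) (r 6%nat) p)); try lia.
  - intros i. cbn [wrR mov_r]. intros [H|[H|[H|H]]]; try apply (proj1 wr_part) in H; lia.
  - cbn [wrN mov_r]. pose proof (fun a => proj2 wr_part a) as W.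
    repeat split; intros H; repeat first [contradiction | apply W in H; lia | destruct H as [H|H]].
  - eapply ready_frame; [exact Hrd|apply HK| | |]; intros; upd; reflexivity.
  - cbv beta. intros p r2 n2 r3 n3 [H1 H1'] H2 H3. rewrite !H2 by lia. auto.
  - cbv beta. upd. rewrite ?Z1, ?H8, ?Rplus_0_r. split; reflexivity.
  - intros p x s r2 n2 HL [HI1 HI2] Hrd2 E0 E1 E2 E3 Hfr2 Hfn2.
    assert (Hz : forall i, (i <= 6)%nat -> r2 i = r i).
    { intros i Hi. rewrite Hfr2; [|lia|].
      - upd. rewrite Hfr by lia. upd. reflexivity.
      - cbn [wrR mov_r]. intros [H|[H|[H|H]]]; try apply (proj1 wr_part) in H; lia. }
    cbn [wp effect mov_r].
    eapply (wp_part B K G L); [lia| |].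
    { eapply ready_frame; [exact Hrd2|apply HK| | |]; intros; upd; reflexivity. }
    intros r4 n4 G8 Gfr Gfn Grd. cbn in E1.
    revert G8; upd. rewrite E1, !Hz, H0, Rplus_0_r by lia. intros G8.
    assert (Y9 : r4 9%nat = r2 9%nat) by (rewrite Gfr by lia; upd; reflexivity).
    assert (Y10 : r4 10%nat = r2 10%nat) by (rewrite Gfr by lia; upd; reflexivity).
    assert (Y0 : r4 0%nat = 0) by (rewrite Gfr by lia; upd; rewrite Hz by lia; assumption).
    unfold mx, mn. rewrite !fold_left_app. cbn [fold_left].
    fold (mx L (r 3%nat) (r 6%nat) p) (mn L (r 3%nat) (r 6%nat) p). unfold Rmax, Rmin.
    rewrite <- HI1, <- HI2, <- G8, <- Y9, <- Y10.
    split; intros Hl1; split; intros Hl2; revert Hl2; upd; rewrite ?Y0; intros Hl2;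
      (split; upd; match goal with |- context [Rle_dec ?a ?b] => destruct (Rle_dec a b) end; lra).
  - intros r2 n2 [HI1 HI2] Hrd2 Hfr2 Hfn2. apply HQ; auto.
    + intros i Hi. rewrite Hfr2; [|lia|].
      * upd. rewrite Hfr by lia. upd. reflexivity.
      * cbn [wrR mov_r]. intros [H|[H|[H|H]]]; try apply (proj1 wr_part) in H; lia.
    + intros a Ha. rewrite Hfn2; [apply Hfn; lia|lia|lia|].
      cbn [wrN mov_r]. intros H; pose proof (fun a => proj2 wr_part a) as W.
      repeat first [contradiction | apply W in H; lia | destruct H as [H|H]].
Qed.

Definition totals_cmd : cmd :=
  Op (RZero 4) ;; Op (RZero 5) ;; Op (RZero 6) ;; Mov 4 3 ;;
  Loop 4 (Op (RAdd 6 6 1) ;; extrema_cmd ;; Op (RAdd 4 4 9) ;; Op (RAdd 5 5 10)).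

Lemma wp_totals B K G L Q r n :
  (30 <= K <= G /\ length L <= B /\ n 3%nat <= B)%nat -> ready G L r n ->
  r 0%nat = 0 -> r 1%nat = 1 ->
  (forall r' n', r' 4%nat = hi L (r 3%nat) (n 3%nat) ->
     r' 5%nat = lo L (r 3%nat) (n 3%nat) ->
     (forall i, (i <= 3)%nat -> r' i = r i) ->
     (forall a, (a <= 3)%nat -> n' a = n a) -> ready G L r' n' -> Q r' n') ->
  wp B totals_cmd Q r n.
Proof.
  intros HK Hr H0 H1 HQ. unfold totals_cmd. cbn [wp effect]. apply wp_Mov; [lia|].
  exists (fun j r' n' => exists i, (i + j = n 3)%nat /\
    r' 4%nat = sumf (fun f => mx L (r 3%nat) (INR (S f)) L) (seq 0 i) /\
    r' 5%nat = sumf (fun f => mn L (r 3%nat) (INR (S f)) L) (seq 0 i) /\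
    r' 6%nat = INR i /\
    (forall i, (i <= 3)%nat -> r' i = r i) /\
    (forall a, (a <= 3)%nat -> n' a = n a) /\ ready G L r' n').
  split; [upd; lia|]. split; [|split].
  - exists 0%nat. upd. split; [lia|]. split; [reflexivity|]. split; [reflexivity|].
    split; [reflexivity|]. split; [intros; upd; reflexivity|].
    split; [intros; upd; reflexivity|].
    eapply ready_frame; [exact Hr|apply HK| | |]; intros; upd; reflexivity.
  - intros j r1 n1 (i & Hi & E4 & E5 & E6 & Hfr & Hfn & Hrd) Hj.
    eapply (wp_extrema B K G L); [lia| | |].
    + eapply ready_frame; [exact Hrd|apply HK| | |]; intros; upd; reflexivity.
    + upd. rewrite Hfr by lia. assumption.
    + intros r2 n2 E9 E10 Gfr Gfn Grd. cbn [wp effect].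
      (* The code register is incremented before use, so the round of feature [i] works with
         [INR (S i)]. *)
      assert (EI : r1 6%nat + r1 1%nat = INR (S i)) by (rewrite E6, Hfr, H1, S_INR by lia; reflexivity).
      rewrite updR_eq in E9, E10. rewrite EI in E9, E10.
      rewrite updR_ne, Hfr in E9, E10 by lia.
      split; [rewrite Gfn by lia; upd; reflexivity|].
      exists (S i). rewrite seq_S. simpl (0 + i)%nat. rewrite !sumf_snoc.
      split; [lia|]. split; [upd; rewrite Gfr by lia; upd; rewrite E4, E9; reflexivity|].
      split; [upd; rewrite Gfr by lia; upd; rewrite E5, E10; reflexivity|].
      split; [upd; rewrite Gfr by lia; upd; assumption|].
      split; [intros; upd; rewrite Gfr by lia; upd; auto|].
      split; [intros; rewrite Gfn by lia; upd; auto|].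
      eapply ready_frame; [exact Grd|apply HK| | |]; intros; upd; reflexivity.
  - intros r1 n1 (i & Hi & E4 & E5 & E6 & Hfr & Hfn & Hrd) Hj.
    replace i with (n 3%nat) in * by lia. apply HQ; assumption.
Qed.

Definition low_cmd : cmd :=
  Op (RZero 3) ;; for_recs 5 6 20 (IfLt 3 21 Skip (Op (RSub 3 21 1))).

Lemma wp_low B K G L Q r n :
  (30 <= K <= G /\ length L <= B)%nat -> ready G L r n -> r 1%nat = 1 ->
  (forall r' n', (forall x, In x L -> r' 3%nat < rt x) ->
     (forall i, (i <= 2)%nat -> r' i = r i) ->
     (forall a, (a <= 3)%nat -> n' a = n a) -> ready G L r' n' -> Q r' n') ->
  wp B low_cmd Q r n.
Proof.
  intros HK Hr H1 HQ. unfold low_cmd. cbn [wp effect].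
  eapply (wp_for_recs B K G L 5 6 20 _
    (fun p r' n' => forall x, In x p -> r' 3%nat < rt x)); try lia.
  - cbn. intros; lia.
  - cbn. lia.
  - eapply ready_frame; [exact Hr|apply HK| | |]; intros; upd; reflexivity.
  - cbv beta. intros p r1 n1 r2 n2 E1 E2 E3 x Hx. rewrite E2 by lia. auto.
  - intros x [].
  - intros p x s r1 n1 HL HI Hrd E0 E1 E2 E3 Hfr Hfn.
    cbn in E1. cbn [wp effect]. rewrite E1, (Hfr 1%nat) by (cbn; lia). upd. rewrite H1.
    (* The register only ever decreases, so the bounds for earlier records persist. *)
    split; intros Hl y Hy; apply in_app_or in Hy; destruct Hy as [Hy|[->|[]]]; upd; auto; try lra.
    apply HI in Hy. lra.
  - intros r1 n1 HI Hrd Hfr Hfn. apply HQ; auto.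
    + intros i Hi. rewrite Hfr by (cbn; lia). upd; reflexivity.
    + intros. apply Hfn; cbn; lia.
Qed.

(* Nesting level [i] of the enumeration keeps the code and the threshold of
   its current record in real registers [40 + 4 * i] and [41 + 4 * i]. *)
Fixpoint look_cmd (i j : nat) : cmd :=
  match j with
  | O => mov_r 7 3
  | S j => look_cmd (S i) j ;; IfEq (40 + 4 * i) 20 (mov_r 7 (41 + 4 * i))
  end.

Fixpoint holds (r : nat -> R) (i : nat) (ov : list rcd) : Prop :=
  match ov with
  | [] => True
  | x :: ov => r (40 + 4 * i)%nat = rc x /\ r (41 + 4 * i)%nat = rt x /\ holds r (S i) ov
  end.

Lemma holds_frame r r' i ov :
  holds r i ov -> (forall a, (40 + 4 * i <= a)%nat -> r' a = r a) -> holds r' i ov.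
Proof.
  revert i. induction ov as [|x ov IH]; intros i H Hf; simpl; [trivial|].
  destruct H as (H1 & H2 & H3). split; [|split].
  - rewrite <- H1. apply Hf. lia.
  - rewrite <- H2. apply Hf. lia.
  - apply IH; [assumption|]. intros. apply Hf. lia.
Qed.

Lemma wp_look B ov : forall i Q r n,
  holds r i ov -> r 0%nat = 0 ->
  Q (updR r 7 (look (r 3%nat) ov (r 20%nat))) n ->
  wp B (look_cmd i (length ov)) Q r n.
Proof.
  induction ov as [|x ov IH]; intros i Q r n H H0 HQ; cbn [length look_cmd wp look mov_r effect] in *.
  - rewrite H0, Rplus_0_r. assumption.
  - destruct H as (H1 & H2 & H3). apply IH; [assumption..|].
    apply wp_IfEq; upd; rewrite H1; intros Heq;
      destruct (Req_dec_T (rc x) (r 20%nat)); try contradiction; [|assumption].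
    cbn [wp effect mov_r]. upd. rewrite H2, H0, Rplus_0_r.
    replace (updR (updR r 7 (look (r 3%nat) ov (r 20%nat))) 7 (rt x)) with (updR r 7 (rt x));
      [assumption|].
    apply functional_extensionality; intros a. unfold updR. destruct (Nat.eqb a 7); reflexivity.
Qed.

Lemma wr_look i j :
  (forall a, wrR (look_cmd i j) a -> a = 7%nat) /\ (forall a, wrN (look_cmd i j) a -> False).
Proof.
  revert i. induction j as [|j IH]; intros i; cbn [look_cmd wrR wrN mov_r IfEq].
  - auto.
  - destruct (IH (S i)) as [H1 H2].
    split; intros a [H|H]; [apply H1 in H|..|apply H2 in H|]; tauto.
Qed.

(** Only strict comparisons exist, so each test skips when the strict opposite holds. A successful
    test sets the flag in register 0 and a failed one leaves it alone, which makes the enumeration a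
    disjunction. *)
Definition test_cmd : cmd :=
  Op (RAdd 11 8 4) ;; Op (RSub 12 0 11) ;; Op (RExp 12 12) ;; Op (RAdd 12 12 1) ;;
  Op (RAdd 13 1 2) ;; Op (RAdd 13 13 2) ;; Op (RMul 13 13 12) ;; Op (RAdd 14 1 1) ;;
  IfLt 14 13 Skip
    (Op (RAdd 11 8 5) ;; Op (RSub 12 0 11) ;; Op (RExp 12 12) ;; Op (RAdd 12 12 1) ;;
     Op (RSub 13 1 2) ;; Op (RSub 13 13 2) ;; Op (RMul 13 13 12) ;;
     IfLt 13 14 Skip (Op (NZero 0) ;; Op (NSucc 0))).

Definition check_cmd (k : nat) : cmd :=
  Op (RZero 8) ;;
  for_recs 5 6 20 (IfLt 20 0 (look_cmd 0 k ;; eval_cmd 20) Skip) ;;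
  test_cmd.

Definition env (G : nat) (L : list rcd) (d : nat) (g low : R)
  (r : nat -> R) (n : nat -> nat) : Prop :=
  ready G L r n /\ r 0%nat = 0 /\ r 1%nat = 1 /\ r 2%nat = g /\ r 3%nat = low /\
  r 4%nat = hi L low d /\ r 5%nat = lo L low d.

Lemma env_frame K G L d g low r n r' n' :
  env G L d g low r n -> (K <= G)%nat ->
  (forall i, (i <= 5)%nat \/ (K <= i)%nat -> r' i = r i) ->
  n' 1%nat = n 1%nat -> n' 2%nat = n 2%nat -> env G L d g low r' n'.
Proof.
  intros (H & H0 & H1 & H2 & H3 & H4 & H5) HK Hr Hn1 Hn2.
  split; [eapply ready_frame; eauto|]. rewrite !Hr by lia. auto 10.
Qed.

Lemma wp_check B K G L d g low ov Q r n :
  (30 <= K <= G /\ length L <= B)%nat -> env G L d g low r n -> holds r 0 ov ->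
  (forall r' n', (n' 0%nat <> 0%nat <-> n 0%nat <> 0%nat \/ accept L low d g ov) -> Q r' n') ->
  wp B (check_cmd (length ov)) Q r n.
Proof.
  intros HK He Hh HQ. pose proof He as (Hr & H0 & H1 & H2 & H3 & H4 & H5).
  pose proof (wr_look 0 (length ov)) as [WR WN].
  assert (WR' : forall a, wrR (IfLt 20 0 (look_cmd 0 (length ov);; eval_cmd 20) Skip) a ->
                 a = 7%nat \/ a = 8%nat).
  { cbn. intros a [[H|H]|H]; [apply WR in H|..]; lia. }
  assert (WN' : forall a, ~ wrN (IfLt 20 0 (look_cmd 0 (length ov);; eval_cmd 20) Skip) a).
  { cbn. intros a [[H|H]|H]; [apply WN in H|..]; tauto. }
  unfold check_cmd. cbn [wp effect].
  eapply (wp_for_recs B K G L 5 6 20 _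
    (fun p r' n' => r' 8%nat = fixpart p low ov)); try lia.
  - intros i H. apply WR' in H. lia.
  - auto.
  - eapply ready_frame; [exact Hr|apply HK| | |]; intros; upd; reflexivity.
  - cbv beta. intros p r1 n1 r2 n2 E1 E2 E3. rewrite E2 by lia. auto.
  - reflexivity.
  - intros p x s r1 n1 HL HI Hrd E0 E1 E2 E3 Hfr Hfn. unfold fixpart in *. rewrite sumf_snoc.
    assert (Hf : forall i, i <> 7%nat -> i <> 8%nat -> ~ (20 <= i <= 23)%nat -> r1 i = r i).
    { intros i Ha Hb Hc. rewrite Hfr; [upd; reflexivity|lia|]. intros Hw. apply WR' in Hw. lia. }
    cbn [wp]. rewrite E0, (Hf 0%nat), H0 by lia. split; intros Hc.
    + destruct (Rlt_dec (rc x) 0); [|contradiction].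
      apply wp_look; [|rewrite Hf by lia; assumption|].
      { eapply holds_frame; [exact Hh|]. intros. apply Hf; lia. }
      rewrite (Hf 3%nat), H3, E0 by lia. cbn [wp effect eval_cmd].
      upd. rewrite E1, E2, E3, HI. 
      change (ev (look low ov (rc x)) x) with
        (if Rlt_dec (look low ov (rc x)) (rt x) then ry x else rn x).
      destruct (Rlt_dec (look low ov (rc x)) (rt x)); split; intros; try contradiction; lra.
    + destruct (Rlt_dec (rc x) 0); [contradiction|]. rewrite HI; lra.
  - intros r1 n1 HI Hrd Hfr Hfn.
    assert (Hf : forall i, (i <= 5)%nat -> r1 i = r i).
    { intros i Ha. rewrite Hfr; [upd; reflexivity|lia|]. intros Hw. apply WR' in Hw. lia. }
    assert (Hf0 : n1 0%nat = n 0%nat) by (apply Hfn; [lia|lia|apply WN']).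
    unfold test_cmd. cbv beta iota delta [wp effect updR updN Nat.eqb]. rewrite HI, !Hf, H0, H1, H2, H4, H5 by lia.
    unfold accept, up_ok, dn_ok in HQ.
    split; intros Hl1; [|split; intros Hl2]; apply HQ; cbv beta iota; rewrite ?Hf0.
    + split; [auto|]. intros [H|[Hu Hd]]; [assumption|lra].
    + split; [auto|]. intros [H|[Hu Hd]]; [assumption|lra].
    + split; [|discriminate]. intros _. right. split; lra.
Qed.

Lemma wr_check k :
  (forall a, wrR (check_cmd k) a -> (7 <= a <= 23)%nat) /\
  (forall a, wrN (check_cmd k) a -> (a = 0 \/ a = 5 \/ a = 6)%nat).
Proof.
  pose proof (wr_look 0 k) as [WR WN]. unfold check_cmd, test_cmd.
  split; cbn [wrR wrN eval_cmd]; intros a H;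
  repeat first [contradiction | apply WR in H; lia | apply WN in H; lia
    | lia | apply wrR_for_recs in H; cbn [wrR eval_cmd] in H
    | apply wrN_for_recs in H; cbn [wrN eval_cmd] in H | destruct H as [H|H]].
Qed.

(** * Enumeration of the tuples *)

Fixpoint enum_cmd (k i : nat) : cmd :=
  match i with
  | O => check_cmd k
  | S i => for_recs (20 + 2 * i) (21 + 2 * i) (40 + 4 * i) (enum_cmd k i)
  end.

Lemma wr_enum k i :
  (forall a, wrR (enum_cmd k i) a -> (7 <= a <= 23 \/ 40 <= a < 40 + 4 * i)%nat) /\
  (forall a, wrN (enum_cmd k i) a -> (a = 0 \/ a = 5 \/ a = 6 \/ 20 <= a < 20 + 2 * i)%nat).
Proof.
  induction i as [|i [IH1 IH2]]; cbn [enum_cmd].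
  - destruct (wr_check k) as [W1 W2]. split; intros a H; [apply W1 in H|apply W2 in H]; lia.
  - split; intros a H; [apply wrR_for_recs in H|apply wrN_for_recs in H].
    + destruct H as [H|H]; [|apply IH1 in H]; lia.
    + destruct H as [H|[H|H]]; [| |apply IH2 in H]; lia.
Qed.

(** Here [outs] are the records chosen by the enclosing loops. The outermost loop fixes the last
    position of the tuple, so the [i] positions still open come in front. *)
Lemma wp_enum B K G L d g low k i : forall outs r n,
  (40 + 4 * k <= K <= G /\ length L <= B /\ i + length outs = k)%nat ->
  env G L d g low r n -> holds r i outs ->
  wp B (enum_cmd k i) (fun r' n' => n' 0%nat <> 0%nat <-> n 0%nat <> 0%nat \/
    exists inn, length inn = i /\ incl inn L /\ accept L low d g (inn ++ outs)) r n.
Proof.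
  induction i as [|i IH]; intros outs r n HK He Hh; cbn [enum_cmd].
  - replace k with (length outs) by lia. eapply (wp_check B K); try eassumption; [lia|].
    intros r' n' H. rewrite H. split; (intros [H'|H']; [left; assumption|right]).
    + exists []. split; [reflexivity|]. split; [intros x []|assumption].
    + destruct H' as ([|x l] & H1 & H2 & H3); [assumption|discriminate].
  - destruct (wr_enum k i) as [W1 W2].
    eapply (wp_for_recs B K G L _ _ _ _ (fun p r' n' => n' 0%nat <> 0%nat <-> n 0%nat <> 0%nat \/
      exists x inn, In x p /\ length inn = i /\ incl inn L /\
        accept L low d g (inn ++ x :: outs))); try lia.
    + intros a H. apply W1 in H. lia.
    + repeat split; intros H; apply W2 in H; lia.
    + apply He.
    + cbv beta. intros p r1 n1 r2 n2 E1 E2 E3. rewrite E3 by lia. assumption.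
    + cbv beta. split; [auto|]. intros [H|(x & inn & [] & _)]. assumption.
    + intros p x s r1 n1 HL HI Hrd E0 E1 E2 E3 Hfr Hfn.
      eapply wp_mono.
      * apply (IH (x :: outs)); [simpl; lia| |].
        -- eapply (env_frame K); [exact He|lia| | |].
           ++ intros a Ha. apply Hfr; [lia|]. intros H. apply W1 in H. lia.
           ++ apply Hfn; [lia|lia|]. intros H. apply W2 in H. lia.
           ++ apply Hfn; [lia|lia|]. intros H. apply W2 in H. lia.
        -- cbn [holds]. split; [assumption|]. split.
           ++ rewrite <- E1. f_equal. lia.
           ++ eapply holds_frame; [exact Hh|]. intros a Ha. apply Hfr; [lia|].
              intros H. apply W1 in H. lia.
      * cbv beta. intros r2 n2 H. rewrite H, HI. clear - HL.
        split.
        -- intros [[H|(y & inn & Hy & H)]|(inn & H1 & H2)]; [left; assumption|right|right].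
           ++ exists y, inn. split; [apply in_or_app; auto|assumption].
           ++ exists x, inn. split; [apply in_or_app; simpl; auto|tauto].
        -- intros [H|(y & inn & Hy & H)]; [auto|].
           apply in_app_or in Hy. destruct Hy as [Hy|[->|[]]].
           ++ left; right. exists y, inn. tauto.
           ++ right. exists inn. assumption.
    + intros r' n' HI _ _ _. rewrite HI. split; (intros [H|H]; [left; assumption|right]).
      * destruct H as (x & inn & H1 & H2 & H3 & H4). exists (inn ++ [x]).
        rewrite length_app, <- app_assoc. simpl. split; [lia|]. split; [|assumption].
        apply incl_app; [assumption|]. intros y [<-|[]]. assumption.
      * destruct H as (inn & H1 & H2 & H3).
        destruct (exists_last (l := inn)) as (l & x & ->); [intros ->; discriminate|].
        rewrite length_app in H1. simpl in H1. rewrite <- app_assoc in H3.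
        exists x, l. split; [apply H2, in_or_app; simpl; auto|]. split; [lia|].
        split; [|assumption]. intros y Hy. apply H2, in_or_app; auto.
Qed.

Definition main_cmd (k : nat) : cmd :=
  Op (NZero 0) ;; low_cmd ;; totals_cmd ;; enum_cmd k k.

Lemma wp_main B K G L d g k r n :
  (40 + 4 * k <= K <= G /\ length L <= B /\ d <= B)%nat ->
  ready G L r n -> r 0%nat = 0 -> r 1%nat = 1 -> r 2%nat = g -> n 3%nat = d ->
  wp B (main_cmd k) (fun r' n' => exists low, (forall x, In x L -> low < rt x) /\
    (n' 0%nat <> 0%nat <->
     exists ov, length ov = k /\ incl ov L /\ accept L low d g ov)) r n.
Proof.
  intros HK Hr H0 H1 H2 H3. unfold main_cmd. cbn [wp effect].
  eapply (wp_low B K G L); [lia| |assumption|].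
  { eapply ready_frame; [exact Hr|apply HK| | |]; intros; upd; reflexivity. }
  intros r1 n1 Hlow Hfr Hfn Hrd.
  assert (Hd : n1 3%nat = d) by (rewrite Hfn by lia; upd; assumption).
  eapply (wp_totals B K G L); [lia|assumption|rewrite Hfr by lia; assumption..|].
  intros r2 n2 E4 E5 Gfr Gfn Grd. rewrite Hd in E4, E5.
  eapply wp_mono.
  - apply (wp_enum B K G L d g (r1 3%nat) k k []); [simpl; lia| |exact I].
    unfold env. rewrite !Gfr, !Hfr by lia. auto 10.
  - cbv beta. intros r3 n3 H. exists (r1 3%nat). split; [assumption|].
    rewrite H, Gfn, Hfn, updN_eq by lia. split.
    + intros [[]|(inn & E)]; [reflexivity|]. exists inn. rewrite app_nil_r in E. assumption.
    + intros (ov & E). right. exists ov. rewrite app_nil_r. assumption.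
Qed.

(** * Freeing registers and building the table *)

(** Real registers 2, 3 and 5, 6 hold the yes and no values of trees 0 and 1. Once the no-value of
    tree 0 is known to be 0, register 3 can hold the power of two. *)
Definition count_cmd : cmd :=
  Op (RAdd 5 5 3) ;; Op (RAdd 6 6 3) ;; Op (RSub 2 2 3) ;; Op (ROne 3) ;;
  Loop 0 (Op (NSucc 1) ;; Op (RAdd 3 3 3)).

Lemma wp_count B Q r n :
  (n 0 <= B)%nat ->
  (forall r' n', r' 2%nat = r 2%nat - r 3%nat -> r' 3%nat = 2 ^ n 0%nat ->
     r' 5%nat = r 5%nat + r 3%nat -> r' 6%nat = r 6%nat + r 3%nat ->
     (forall i, (i <> 2 /\ i <> 3 /\ i <> 5 /\ i <> 6)%nat -> r' i = r i) ->
     n' 1%nat = (n 1 + n 0)%nat -> (forall a, (2 <= a)%nat -> n' a = n a) -> Q r' n') ->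
  wp B count_cmd Q r n.
Proof.
  intros HB HQ. unfold count_cmd. cbn [wp effect].
  match goal with |- context [updR ?rr 3 1] => set (r1 := rr) end.
  exists (fun j r' n' => exists i, (i + j = n 0)%nat /\ r' 3%nat = 2 ^ i /\
    (forall a, a <> 3%nat -> r' a = r1 a) /\
    n' 1%nat = (n 1 + i)%nat /\ (forall a, (2 <= a)%nat -> n' a = n a)).
  split; [lia|]. split; [|split].
  - exists 0%nat. upd. repeat split; try lia. intros; upd; reflexivity.
  - intros j r' n' (i & Hi & H3 & Hr & H1 & Hn) Hj. upd. split; [reflexivity|].
    exists (S i). upd. rewrite H3, H1. simpl. repeat split; try lia; try lra; intros; upd; auto.
  - intros r' n' (i & Hi & H3 & Hr & H1 & Hn) _. replace i with (n 0%nat) in * by lia.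
    apply HQ; try assumption; try (rewrite Hr by lia; unfold r1; upd; lra).
    intros a Ha. rewrite Hr by lia. unfold r1. upd. reflexivity.
Qed.

(** Straight-line code whose source addresses stand in the text: register 1 is the only pointer, so
    the low cells are copied away before any of them is reused. *)
Fixpoint save_N (j c : nat) : cmd :=
  match c with
  | O => Skip
  | S c => Op (NStore 1 j) ;; Op (NSucc 1) ;; save_N (S j) c
  end.

Lemma wp_save_N B c : forall j Q r n,
  (2 <= j /\ j + c <= n 1)%nat ->
  (forall n', n' 1%nat = (n 1 + c)%nat ->
     (forall i, (i < c)%nat -> n' (n 1 + i)%nat = n (j + i)%nat) ->
     (forall a, a <> 1%nat -> ~ (n 1 <= a < n 1 + c)%nat -> n' a = n a) -> Q r n') ->
  wp B (save_N j c) Q r n.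
Proof.
  induction c as [|c IH]; intros j Q r n Hj HQ; cbn [save_N wp effect].
  - apply HQ; intros; try lia; reflexivity.
  - rewrite (updN_ne n (n 1%nat)) by lia. apply IH; upd; [lia|].
    intros n' H1 H2 H3. apply HQ; [lia| |].
    + intros [|i] Hi.
      * rewrite Nat.add_0_r, H3 by lia. upd. f_equal. lia.
      * replace (n 1 + S i)%nat with (S (n 1) + i)%nat by lia.
        rewrite H2 by lia. upd. f_equal. lia.
    + intros a Ha Hb. rewrite H3 by lia. upd. reflexivity.
Qed.

Fixpoint save_R (j c : nat) : cmd :=
  match c with
  | O => Skip
  | S c => Op (RStore 2 j) ;; Op (NSucc 2) ;; save_R (S j) c
  end.

Lemma wp_save_R B c : forall j Q r n,
  (j + c <= n 2)%nat ->
  (forall r' n', n' 2%nat = (n 2 + c)%nat -> (forall a, a <> 2%nat -> n' a = n a) ->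
     (forall i, (i < c)%nat -> r' (n 2 + i)%nat = r (j + i)%nat) ->
     (forall a, ~ (n 2 <= a < n 2 + c)%nat -> r' a = r a) -> Q r' n') ->
  wp B (save_R j c) Q r n.
Proof.
  induction c as [|c IH]; intros j Q r n Hj HQ; cbn [save_R wp effect].
  - apply HQ; intros; try lia; reflexivity.
  - apply IH; upd; [lia|].
    intros r' n' H1 H2 H3 H4. apply HQ; [lia| | |].
    + intros a Ha. rewrite H2 by lia. upd. reflexivity.
    + intros [|i] Hi.
      * rewrite Nat.add_0_r, H4 by lia. upd. f_equal. lia.
      * replace (n 2 + S i)%nat with (S (n 2) + i)%nat by lia.
        rewrite H3 by lia. upd. f_equal. lia.
    + intros a Hb. rewrite H4 by lia. upd. reflexivity.
Qed.

Definition copy_N : cmd :=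
  Loop 0 (Op (NLoad 4 3) ;; Op (NStore 2 4) ;; Op (NSucc 2) ;; Op (NSucc 3)).

Lemma wp_copy_N B Q r n :
  (n 0 <= B /\ 5 <= n 3 /\ n 3 + n 0 <= n 2)%nat ->
  (forall n', (forall i, (i < n 0)%nat -> n' (n 2 + i)%nat = n (n 3 + i)%nat) ->
     n' 1%nat = n 1%nat ->
     (forall a, (5 <= a)%nat -> ~ (n 2 <= a < n 2 + n 0)%nat -> n' a = n a) -> Q r n') ->
  wp B copy_N Q r n.
Proof.
  intros HB HQ. unfold copy_N. cbn [wp effect].
  exists (fun j r' n' => r' = r /\ exists i, (i + j = n 0)%nat /\
    n' 3%nat = (n 3 + i)%nat /\ n' 2%nat = (n 2 + i)%nat /\ n' 1%nat = n 1%nat /\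
    (forall a, (a < i)%nat -> n' (n 2 + a)%nat = n (n 3 + a)%nat) /\
    (forall a, (5 <= a)%nat -> ~ (n 2 <= a < n 2 + i)%nat -> n' a = n a)).
  split; [lia|]. split; [|split].
  - split; [reflexivity|]. exists 0%nat. repeat split; intros; try lia; reflexivity.
  - intros j r' n' (-> & i & Hi & H3 & H2 & H1 & Hc & Hn) Hj.
    upd. rewrite ?H2, ?H3. upd. rewrite ?H2, ?H3. split; [reflexivity|]. split; [reflexivity|].
    exists (S i). upd. repeat split; try lia.
    + intros a Ha. destruct (Nat.eq_dec a i) as [->|Hne]; upd; [|apply Hc; lia].
      apply Hn; lia.
    + intros a Ha Hb. upd. apply Hn; lia.
  - intros r' n' (-> & i & Hi & H3 & H2 & H1 & Hc & Hn) _.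
    replace i with (n 0%nat) in * by lia. apply HQ; assumption.
Qed.

Definition copy_R : cmd :=
  Loop 0 (Op (RLoad 0 3) ;; Op (RStore 2 0) ;; Op (NSucc 2) ;; Op (NSucc 3)).

Lemma wp_copy_R B Q r n :
  (n 0 <= B /\ 1 <= n 3 /\ n 3 + n 0 <= n 2)%nat ->
  (forall r' n', n' 2%nat = (n 2 + n 0)%nat ->
     (forall a, (a <> 0 /\ a <> 2 /\ a <> 3)%nat -> n' a = n a) ->
     (forall i, (i < n 0)%nat -> r' (n 2 + i)%nat = r (n 3 + i)%nat) ->
     (forall a, (1 <= a)%nat -> ~ (n 2 <= a < n 2 + n 0)%nat -> r' a = r a) -> Q r' n') ->
  wp B copy_R Q r n.
Proof.
  intros HB HQ. unfold copy_R. cbn [wp effect].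
  exists (fun j r' n' => exists i, (i + j = n 0)%nat /\
    n' 3%nat = (n 3 + i)%nat /\ n' 2%nat = (n 2 + i)%nat /\
    (forall a, (a <> 0 /\ a <> 2 /\ a <> 3)%nat -> n' a = n a) /\
    (forall a, (a < i)%nat -> r' (n 2 + a)%nat = r (n 3 + a)%nat) /\
    (forall a, (1 <= a)%nat -> ~ (n 2 <= a < n 2 + i)%nat -> r' a = r a)).
  split; [lia|]. split; [|split].
  - exists 0%nat. repeat split; intros; try lia; reflexivity.
  - intros j r' n' (i & Hi & H3 & H2 & Hn & Hc & Hr) Hj.
    upd. rewrite H2, H3. split; [reflexivity|].
    exists (S i). upd. repeat split; try lia.
    + intros a Ha. upd. auto.
    + intros a Ha. destruct (Nat.eq_dec a i) as [->|Hne]; upd; [|apply Hc; lia].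
      apply Hr; lia.
    + intros a Ha Hb. upd. apply Hr; lia.
  - intros r' n' (i & Hi & H3 & H2 & Hn & Hc & Hr) _.
    replace i with (n 0%nat) in * by lia. apply HQ; assumption.
Qed.

(** Cell [a] goes to [s + K + a] with [s = m + d]; the summand 2 is there because cells 0 and 1 are
    not copied. The cells below [K] are saved by unrolled code, the next [s] by a loop. Register 1
    ends at [s + 2 * K], from which [s] is recovered later. *)
Definition move_N_cmd (K : nat) : cmd :=
  iter_cmd (Op (NSucc 1)) (K + 2) ;; save_N 2 (K - 2) ;;
  Mov 2 1 ;; NConst 3 K ;; Mov 0 1 ;; iter_cmd (Op (NPred 0)) (2 * K) ;; copy_N.

Lemma wp_move_N B K Q r n :
  (50 <= K /\ n 1 <= B)%nat ->
  (forall n', n' 1%nat = (n 1 + 2 * K)%nat ->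
     (forall a, (2 <= a < n 1 + 2)%nat -> n' (n 1 + K + a)%nat = n a) -> Q r n') ->
  wp B (move_N_cmd K) Q r n.
Proof.
  intros HK HQ. unfold move_N_cmd. cbn [wp].
  apply wp_NSuccs. apply wp_save_N; upd; [lia|]. intros n1 H1 H2 H3.
  apply wp_Mov; [lia|]. apply wp_NConst. apply wp_Mov; [lia|]. apply wp_NPreds.
  apply wp_copy_N; upd; [lia|]. rewrite H1.
  intros n2 G1 G2 G3. apply HQ; [lia|].
  intros a Ha. destruct (Nat.lt_ge_cases a K) as [Hlt|Hge].
  - rewrite G3 by lia. upd.
    replace (n 1 + K + a)%nat with (n 1 + (K + 2) + (a - 2))%nat by lia.
    rewrite H2 by lia. upd. f_equal. lia.
  - replace (n 1 + K + a)%nat with (n 1 + (K + 2) + (K - 2) + (a - K))%nat by lia.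
    rewrite G1 by lia. replace (K + (a - K))%nat with a by lia. upd.
    rewrite H3 by lia. upd. reflexivity.
Qed.

(** Cell [a] goes to [E + a] with [E = 3 * s + K], kept in register 7. The loop builds [3 * s] by
    repeated increments. Real register 0 is saved before it becomes the transfer register of
    [copy_R], and register 2 ends at [6 * s + 2 * K], where the table will start. *)
Definition move_R_cmd (K : nat) : cmd :=
  NConst 2 K ;; Op (NZero 5) ;; Mov 0 1 ;; iter_cmd (Op (NPred 0)) (2 * K) ;;
  Loop 0 (iter_cmd (Op (NSucc 2)) 3 ;; iter_cmd (Op (NSucc 5)) 3) ;;
  Mov 7 2 ;; save_R 0 K ;; NConst 3 K ;; Mov 0 5 ;; copy_R.

Lemma wp_move_R B K s Q r n :
  (50 <= K /\ n 1 = s + 2 * K /\ 3 * s <= B)%nat ->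
  (forall r' n', n' 1%nat = n 1%nat -> n' 2%nat = (6 * s + 2 * K)%nat ->
     n' 7%nat = (3 * s + K)%nat -> (forall a, (8 <= a)%nat -> n' a = n a) ->
     (forall a, (a <= 3 * s \/ a < K)%nat -> r' (3 * s + K + a)%nat = r a) -> Q r' n') ->
  wp B (move_R_cmd K) Q r n.
Proof.
  intros HK HQ. unfold move_R_cmd. cbn [wp].
  apply wp_NConst. cbn [wp effect]. apply wp_Mov; [lia|]. apply wp_NPreds.
  exists (fun j r' n' => r' = r /\ exists i, (i + j = s)%nat /\ n' 1%nat = n 1%nat /\
     n' 2%nat = (K + 3 * i)%nat /\ n' 5%nat = (3 * i)%nat /\
     (forall a, (8 <= a)%nat -> n' a = n a)).
  split; [upd; lia|]. split; [|split].
  - split; [reflexivity|]. exists 0%nat. upd. repeat split; try lia. intros; upd; reflexivity.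
  - intros j r1 n1 (-> & i & Hi & H1 & H2 & H5 & Hn) Hj.
    apply wp_NSuccs. apply wp_NSuccs. upd. split; [reflexivity|]. split; [reflexivity|].
    exists (S i). upd. repeat split; try lia. intros; upd; auto.
  - intros r1 n1 (-> & i & Hi & H1 & H2 & H5 & Hn) Hj.
    apply wp_Mov; [lia|]. apply wp_save_R; upd; [lia|].
    intros r2 n2 G2 Gn Gr1 Gr2. apply wp_NConst. apply wp_Mov; [lia|].
    apply wp_copy_R; upd; rewrite ?(Gn 5%nat), ?G2 by lia; upd; [lia|].
    intros r3 n3 E2 En Er1 Er2. apply HQ.
    + rewrite En by lia. upd. rewrite Gn by lia. upd. assumption.
    + lia.
    + rewrite En by lia. upd. rewrite Gn by lia. upd. lia.
    + intros a Ha. rewrite En by lia. upd. rewrite Gn by lia. upd. auto.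
    + intros a Ha. destruct (Nat.lt_ge_cases a K) as [Hlt|Hge].
      * rewrite Er2 by lia. replace (3 * s + K + a)%nat with (n1 2 + a)%nat by lia.
        rewrite Gr1 by lia. reflexivity.
      * replace (3 * s + K + a)%nat with (n1 2 + K + (a - K))%nat by lia.
        rewrite Er1 by lia. replace (K + (a - K))%nat with a by lia. apply Gr2. lia.
Qed.

(** The loop runs [m + d] times, hence at least [d] times, and doubling stops once [2 ^ d] is
    reached. Each doubling adds one to register 3 and takes one from [m + d] in register 4, so they
    end as [d] and [m]. *)
Definition decode_cmd (K : nat) : cmd :=
  Op (ROne 0) ;; Mov 6 7 ;; iter_cmd (Op (NSucc 6)) 3 ;; Op (RLoad 1 6) ;;
  Op (NZero 3) ;; Mov 4 1 ;; iter_cmd (Op (NPred 4)) (2 * K) ;; Mov 0 4 ;;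
  Loop 0 (IfLt 0 1 (Op (RAdd 0 0 0) ;; Op (NSucc 3) ;; Op (NPred 4)) Skip).

Lemma wp_decode B K m d Q r n :
  (n 1 = m + d + 2 * K /\ m + d <= B /\ 1 <= n 7)%nat ->
  r (n 7 + 3)%nat = 2 ^ d ->
  (forall r' n', n' 3%nat = d -> n' 4%nat = m -> n' 6%nat = (n 7 + 3)%nat ->
     (forall a, (a = 1 \/ a = 2 \/ 7 <= a)%nat -> n' a = n a) ->
     (forall a, (2 <= a)%nat -> r' a = r a) -> Q r' n') ->
  wp B (decode_cmd K) Q r n.
Proof.
  intros HK Hd HQ. unfold decode_cmd. cbn [wp effect].
  apply wp_Mov; [lia|]. apply wp_NSuccs. upd. rewrite Hd.
  apply wp_Mov; [lia|]. apply wp_NPreds. apply wp_Mov; [lia|]. upd.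
  exists (fun j r' n' => exists i, (i + j = m + d)%nat /\
    n' 3%nat = Nat.min i d /\ n' 4%nat = (m + d - Nat.min i d)%nat /\
    r' 0%nat = 2 ^ Nat.min i d /\ r' 1%nat = 2 ^ d /\
    n' 6%nat = (n 7 + 3)%nat /\
    (forall a, (a = 1 \/ a = 2 \/ 7 <= a)%nat -> n' a = n a) /\
    (forall a, (2 <= a)%nat -> r' a = r a)).
  split; [lia|]. split; [|split].
  - exists 0%nat. simpl Nat.min. upd. repeat split; try lia; intros; upd; reflexivity.
  - intros j r1 n1 (i & Hi & H3 & H4 & H0 & H1 & H6 & Hn & Hr) Hj.
    rewrite H0, H1. split; intros Hlt; upd.
    + assert (i < d)%nat.
      { destruct (Nat.lt_ge_cases i d); [assumption|]. rewrite Nat.min_r in Hlt by lia. lra. }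
      split; [reflexivity|]. exists (S i). upd. rewrite ?H3, ?H4, ?H0.
      rewrite !Nat.min_l by lia.
      repeat split; try lia; try (simpl; lra); intros; upd; auto.
    + assert (d <= i)%nat.
      { destruct (Nat.lt_ge_cases i d) as [Hid|]; [|assumption]. rewrite Nat.min_l in Hlt by lia.
        pose proof (Rlt_pow 2 i d ltac:(lra) Hid). lra. }
      split; [reflexivity|]. exists (S i). upd. rewrite ?H3, ?H4, ?H0, ?H1.
      rewrite !Nat.min_r by lia.
      repeat split; try lia; intros; upd; auto.
  - intros r1 n1 (i & Hi & H3 & H4 & H0 & H1 & H6 & Hn & Hr) Hj.
    replace i with (m + d)%nat in * by lia. rewrite Nat.min_r in H3, H4 by lia.
    apply HQ; auto; lia.
Qed.

(** The value in real register 0 becomes the no-value of tree 0, in place of the power of two, and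
    is added to its yes-value. The gap is fetched from the copy of cell 0. *)
Definition restore_cmd : cmd :=
  Op (RStore 6 0) ;; Op (NPred 6) ;; Op (RLoad 1 6) ;; Op (RAdd 1 1 0) ;;
  Op (RStore 6 1) ;; Op (RLoad 3 7).

Lemma wp_restore B E Q r n :
  (50 <= E /\ n 6 = E + 3 /\ n 7 = E)%nat ->
  (forall r' n', r' (E + 3)%nat = r 0%nat -> r' (E + 2)%nat = r (E + 2)%nat + r 0%nat ->
     r' 3%nat = r E ->
     (forall a, (50 <= a /\ a <> E + 2 /\ a <> E + 3)%nat -> r' a = r a) ->
     (forall a, a <> 6%nat -> n' a = n a) -> Q r' n') ->
  wp B restore_cmd Q r n.
Proof.
  intros (HE & H6 & H7) HQ. unfold restore_cmd. cbn [wp effect]. upd.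
  rewrite H6, H7. replace (Nat.pred (E + 3)) with (E + 2)%nat by lia. upd.
  apply HQ; intros; upd; reflexivity.
Qed.

(* The counting phase added the no-value of tree 0 to both values of tree 1;
   without a tree 1 it has to be put back. *)
Definition choose_cmd : cmd :=
  IfZ 5 (Mov 8 6 ;; iter_cmd (Op (NSucc 8)) 3 ;; Op (RLoad 0 8)) Skip ;;
  restore_cmd.

Definition repair_cmd : cmd :=
  Mov 5 4 ;; Op (NPred 5) ;; Op (RZero 0) ;; choose_cmd.

Lemma wp_repair B E Q r n :
  (50 <= E /\ n 6 = E + 3 /\ n 7 = E)%nat ->
  (forall r' n', let v := if (n 4 <=? 1)%nat then r (E + 6)%nat else 0 in
     r' (E + 3)%nat = v -> r' (E + 2)%nat = r (E + 2)%nat + v -> r' 3%nat = r E ->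
     (forall a, (50 <= a /\ a <> E + 2 /\ a <> E + 3)%nat -> r' a = r a) ->
     (forall a, (a <> 5 /\ a <> 6 /\ a <> 8)%nat -> n' a = n a) -> Q r' n') ->
  wp B repair_cmd Q r n.
Proof.
  intros HE HQ. unfold repair_cmd.
  assert (Hfin : forall r1 n1, r1 0%nat = (if (n 4 <=? 1)%nat then r (E + 6)%nat else 0) ->
    (forall a, (1 <= a)%nat -> r1 a = r a) ->
    (forall a, (a <> 5 /\ a <> 8)%nat -> n1 a = n a) -> wp B restore_cmd Q r1 n1).
  { intros r1 n1 H0 Hr Hn. apply (wp_restore B E); [rewrite !Hn by lia; lia|].
    intros r' n' H1 H2 H3 H4 H5. rewrite H0 in *. rewrite !Hr in * by lia.
    apply HQ; try assumption; intros; [rewrite H4, Hr|rewrite H5, Hn]; auto; lia. }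
  assert (Hz : forall r1 n1, r1 0%nat = 0 -> (forall a, (1 <= a)%nat -> r1 a = r a) ->
    n1 5%nat = Nat.pred (n 4%nat) -> (forall a, a <> 5%nat -> n1 a = n a) ->
    wp B choose_cmd Q r1 n1).
  { intros r1 n1 H0 Hr H5 Hn. unfold choose_cmd. cbn [wp effect]. split; intros Hm.
    - apply wp_Mov; [lia|]. apply wp_NSuccs. apply Hfin; intros; upd; auto; [|apply Hn; lia].
      rewrite (proj2 (Nat.leb_le (n 4%nat) 1)) by lia. rewrite Hn, Hr by lia. f_equal. lia.
    - apply Hfin; auto; [|intros; apply Hn; lia].
      rewrite (proj2 (Nat.leb_gt (n 4%nat) 1)) by lia. assumption. }
  cbn [wp effect]. apply wp_Mov; [lia|]. apply Hz; intros; upd; reflexivity.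
Qed.

(** * Writing the records *)

Definition push : cmd := Op (RStore 2 0) ;; Op (NSucc 2).
Definition move : cmd := Op (RLoad 0 7) ;; Op (NSucc 7) ;; push.

Lemma wp_move B p q Q r n :
  (n 7 = p /\ n 2 = q /\ 1 <= q)%nat ->
  (forall r' n', r' q = r p -> (forall a, (a <> 0 /\ a <> q)%nat -> r' a = r a) ->
     n' 7%nat = (p + 1)%nat -> n' 2%nat = (q + 1)%nat ->
     (forall a, (a <> 2 /\ a <> 7)%nat -> n' a = n a) -> Q r' n') ->
  wp B move Q r n.
Proof.
  intros (H7 & H2 & Hq) HQ. unfold move, push. cbn [wp effect]. upd. rewrite H2, H7.
  apply HQ; intros; upd; try lia; reflexivity.
Qed.

(** One loop does two jobs: real register 0 counts up to [f + 1], while register 12 walks to the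
    cell with the bit of [f]. That bit then decides the sign of the code. *)
Definition record_cmd : cmd :=
  Op (NLoad 11 9) ;; Op (NSucc 9) ;; Mov 12 10 ;; Op (ROne 0) ;;
  Loop 11 (Op (RAdd 0 0 1) ;; Op (NSucc 12)) ;;
  Op (NLoad 12 12) ;; IfZ 12 (Op (RZero 2) ;; Op (RSub 0 2 0)) Skip ;;
  push ;; move ;; move ;; move.

(* The sign tells free features from fixed ones; code 0 is left for [dummy]. *)
Definition code (b : bool) (f : nat) : R := if b then INR (S f) else - INR (S f).

Lemma wp_record B f Q r n :
  (50 <= n 7 /\ n 7 + 3 <= n 2 /\ 50 <= n 9 /\ 50 <= n 10 /\ n (n 9%nat) = f /\ f <= B)%nat ->
  r 1%nat = 1 ->
  (forall r' n', r' (n 2%nat) = code (negb (n (n 10 + f)%nat =? 0)%nat) f ->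
     r' (n 2 + 1)%nat = r (n 7%nat) -> r' (n 2 + 2)%nat = r (n 7 + 1)%nat ->
     r' (n 2 + 3)%nat = r (n 7 + 2)%nat ->
     n' 2%nat = (n 2 + 4)%nat -> n' 7%nat = (n 7 + 3)%nat -> n' 9%nat = (n 9 + 1)%nat ->
     (forall a, (a <> 0 /\ a <> 2)%nat -> ~ (n 2 <= a < n 2 + 4)%nat -> r' a = r a) ->
     (forall a, (a <> 2 /\ a <> 7 /\ a <> 9 /\ a <> 11 /\ a <> 12)%nat -> n' a = n a) ->
     Q r' n') ->
  wp B record_cmd Q r n.
Proof.
  intros Hn H1 HQ. unfold record_cmd. cbn [wp effect]. apply wp_Mov; [lia|].
  exists (fun j r' n' => exists i, (i + j = f)%nat /\ r' 0%nat = INR (S i) /\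
     (forall a, a <> 0%nat -> r' a = r a) /\
     n' 12%nat = (n 10 + i)%nat /\ n' 9%nat = (n 9 + 1)%nat /\
     (forall a, (a <> 9 /\ a <> 11 /\ a <> 12)%nat -> n' a = n a)).
  split; [upd; lia|]. split; [|split].
  - exists 0%nat. upd. repeat split; try lia; intros; upd; reflexivity.
  - intros j r1 n1 (i & Hi & H0 & Hr & H12 & H9 & Hfn) Hj. upd. split; [reflexivity|].
    exists (S i). upd. rewrite (S_INR (S i)), H0, Hr, H1 by lia.
    repeat split; try lia; intros; upd; auto.
  - intros r1 n1 (i & Hi & H0 & Hr & H12 & H9 & Hfn) Hj.
    replace i with f in * by lia. rewrite H12, (Hfn (n 10 + f)%nat) by lia.
    assert (E2 : n1 2%nat = n 2%nat) by (apply Hfn; lia).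
    assert (E7 : n1 7%nat = n 7%nat) by (apply Hfn; lia).
    assert (Hfin : forall r2 n2, r2 0%nat = code (negb (n (n 10 + f)%nat =? 0)%nat) f ->
      (forall a, (a <> 0 /\ a <> 2)%nat -> r2 a = r a) ->
      n2 2%nat = n 2%nat -> n2 7%nat = n 7%nat -> n2 9%nat = (n 9 + 1)%nat ->
      (forall a, (a <> 9 /\ a <> 11 /\ a <> 12)%nat -> n2 a = n a) ->
      wp B (push ;; move ;; move ;; move) Q r2 n2).
    { clear - HQ Hn. intros r2 n2 H0 Hr E2 E7 E9 Hfn. cbn [wp push effect]. rewrite E2.
      apply (wp_move _ (n 7%nat) (n 2 + 1)%nat); [upd; lia|]. intros r3 n3 A1 A2 A3 A4 A5.
      apply (wp_move _ (n 7 + 1)%nat (n 2 + 2)%nat); [lia|]. intros r4 n4 B1 B2 B3 B4 B5.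
      apply (wp_move _ (n 7 + 2)%nat (n 2 + 3)%nat); [lia|]. intros r5 n5 C1 C2 C3 C4 C5.
      apply HQ.
      - rewrite C2, B2, A2, updR_eq by lia. assumption.
      - rewrite C2, B2, A1, updR_ne by lia. apply Hr. lia.
      - rewrite C2, B1, A2, updR_ne by lia. apply Hr. lia.
      - rewrite C1, B2, A2, updR_ne by lia. apply Hr. lia.
      - lia.
      - lia.
      - rewrite C5, B5, A5, updN_ne by lia. assumption.
      - intros a Ha Hb. rewrite C2, B2, A2, updR_ne by lia. apply Hr. lia.
      - intros a Ha. rewrite C5, B5, A5, updN_ne by lia. apply Hfn. lia. }
    split; intros Hz; revert Hz; upd; intros Hz; apply Hfin; upd; auto.
    + rewrite Hz. cbn [Nat.eqb negb code]. rewrite H0. lra.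
    + intros; upd. apply Hr. lia.
    + intros; upd. apply Hfn; lia.
    + rewrite (proj2 (Nat.eqb_neq _ _) Hz). cbn [negb code]. exact H0.
    + intros; apply Hr; lia.
    + intros; upd. apply Hfn; lia.
Qed.

Lemma recs_at_snoc r G L x :
  recs_at r G L -> r (G + 4 * length L)%nat = rc x -> r (G + 4 * length L + 1)%nat = rt x ->
  r (G + 4 * length L + 2)%nat = ry x -> r (G + 4 * length L + 3)%nat = rn x ->
  recs_at r G (L ++ [x]).
Proof.
  intros H E0 E1 E2 E3 i y Hy. destruct (Nat.lt_ge_cases i (length L)) as [Hi|Hi].
  - rewrite nth_error_app1 in Hy by assumption. auto.
  - rewrite nth_error_app2 in Hy by assumption.
    destruct (i - length L)%nat as [|[|]] eqn:Hd; try discriminate. injection Hy as <-.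
    replace i with (length L) by lia. auto.
Qed.

Lemma recs_at_frame r r' G L :
  recs_at r G L -> (forall a, (G <= a < G + 4 * length L)%nat -> r' a = r a) -> recs_at r' G L.
Proof.
  intros H Hf i x Hx. pose proof (proj1 (nth_error_Some L i) ltac:(congruence)).
  apply H in Hx. rewrite !Hf by lia. assumption.
Qed.

(* Choosing the dummy record in the enumeration means no assignment at all. *)
Definition dummy : rcd := Rcd 0 0 0 0.

(** The four pushed zeros form [dummy], the first record. Register 9 becomes [s + K + 2], the copy
    of cell 2, where the features start; the bits of [F] lie [m] cells further on, in register
    10. *)
Definition pointers_cmd (K : nat) : cmd :=
  Mov 8 2 ;; Op (RZero 0) ;; Op (ROne 1) ;; push ;; push ;; push ;; push ;;
  Mov 9 1 ;; iter_cmd (Op (NPred 9)) (K - 2) ;; Mov 10 9 ;; Mov 0 4 ;;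
  Loop 0 (Op (NSucc 10)) ;; Op (NSucc 7) ;; Mov 0 4.

Lemma wp_pointers B K s E G m Q r n :
  (50 <= K /\ n 1 = s + 2 * K /\ n 2 = G /\ n 7 = E /\ n 4 = m /\ 50 <= G /\ m <= B)%nat ->
  (forall r' n', n' 0%nat = m -> n' 2%nat = (G + 4)%nat -> n' 7%nat = (E + 1)%nat -> n' 8%nat = G ->
     n' 9%nat = (s + K + 2)%nat -> n' 10%nat = (s + K + 2 + m)%nat ->
     (forall a, (a = 3 \/ a = 4 \/ 13 <= a)%nat -> n' a = n a) ->
     r' 1%nat = 1 -> (forall a, (2 <= a < G)%nat -> r' a = r a) -> recs_at r' G [dummy] ->
     Q r' n') ->
  wp B (pointers_cmd K) Q r n.
Proof.
  intros (HK & H1 & H2 & H7 & H4 & HG & HB) HQ. unfold pointers_cmd, push. cbn [wp effect].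
  apply wp_Mov; [lia|]. upd. rewrite H2.
  match goal with |- wp _ _ _ ?rr ?nn => set (r1 := rr); set (n1 := nn) end.
  assert (A : forall a, (a <> 2 /\ a <> 8)%nat -> n1 a = n a) by (intros; unfold n1; upd; reflexivity).
  assert (A2 : n1 2%nat = (G + 4)%nat) by (unfold n1; upd; lia).
  assert (A8 : n1 8%nat = G) by (unfold n1; upd; lia).
  assert (R1 : r1 1%nat = 1) by (unfold r1; upd; reflexivity).
  assert (Rf : forall a, (2 <= a < G)%nat -> r1 a = r a) by (intros; unfold r1; upd; reflexivity).
  assert (Rg : recs_at r1 G [dummy]).
  { intros [|[|i]] x Hx; try discriminate. injection Hx as <-. unfold r1. cbn [dummy rc rt ry rn].
    rewrite !Nat.mul_0_r, !Nat.add_0_r. replace (S G) with (G + 1)%nat by lia.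
    replace (S (G + 1)) with (G + 2)%nat by lia. replace (S (G + 2)) with (G + 3)%nat by lia.
    repeat split; upd; reflexivity. }
  clearbody r1 n1.
  apply wp_Mov; [lia|]. apply wp_NPreds. apply wp_Mov; [lia|]. apply wp_Mov; [lia|]. upd.
  exists (fun j r' n' => r' = r1 /\ exists i, (i + j = m)%nat /\ n' 10%nat = (s + K + 2 + i)%nat /\
    n' 9%nat = (s + K + 2)%nat /\
    (forall a, (a <> 0 /\ a <> 9 /\ a <> 10)%nat -> n' a = n1 a)).
  rewrite !A by lia. split; [lia|]. split; [|split].
  - split; [reflexivity|]. exists 0%nat. upd. repeat split; try lia. intros; upd; reflexivity.
  - intros j r' n' (-> & i & Hi & E10 & E9 & En) Hj. upd. split; [reflexivity|].
    split; [reflexivity|]. exists (S i). upd. repeat split; try lia. intros; upd; auto.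
  - intros r' n' (-> & i & Hi & E10 & E9 & En) Hj. apply wp_Mov; [lia|].
    apply HQ; auto; upd; rewrite ?En, ?A by lia; try lia.
    intros a Ha. upd. rewrite En, A by lia. reflexivity.
Qed.

(** Until the table is complete the gap stays in real register 3, since [record_cmd] uses register 2
    as its zero. The record count is [m + 1] because of [dummy]. *)
Definition table_cmd (K : nat) : cmd :=
  pointers_cmd K ;; Loop 0 record_cmd ;;
  Op (RZero 0) ;; Op (RAdd 2 3 0) ;; Mov 1 4 ;; Op (NSucc 1) ;; Mov 2 8.

Lemma wp_table B K s E G l Q r n :
  let m := length l in
  (50 <= K /\ n 1 = s + 2 * K /\ n 2 = G /\ n 7 = E /\ n 4 = m /\ 50 <= E /\
   E + 1 + 3 * m <= G /\ m <= B)%nat ->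
  (forall t x, nth_error l t = Some x -> let f := n (s + K + 2 + t)%nat in
     (f <= B)%nat /\ rc x = code (negb (n (s + K + 2 + m + f)%nat =? 0)%nat) f /\
     r (E + 1 + 3 * t)%nat = rt x /\ r (E + 2 + 3 * t)%nat = ry x /\
     r (E + 3 + 3 * t)%nat = rn x) ->
  (forall r' n', ready G (dummy :: l) r' n' -> r' 0%nat = 0 -> r' 1%nat = 1 ->
     r' 2%nat = r 3%nat -> n' 3%nat = n 3%nat -> Q r' n') ->
  wp B (table_cmd K) Q r n.
Proof.
  intros m HK Hl HQ. unfold table_cmd. cbn [wp effect].
  apply (wp_pointers B K s E G m); [lia|].
  intros r1 n1 A0 A2 A7 A8 A9 A10 An R1 Rf Rg.
  exists (fun j r' n' => exists p q, l = p ++ q /\ length q = j /\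
    n' 9%nat = (s + K + 2 + length p)%nat /\ n' 7%nat = (E + 1 + 3 * length p)%nat /\
    n' 2%nat = (G + 4 * length (dummy :: p))%nat /\ n' 10%nat = (s + K + 2 + m)%nat /\
    n' 8%nat = G /\ (forall a, (a = 3 \/ a = 4 \/ 13 <= a)%nat -> n' a = n a) /\
    r' 1%nat = 1 /\ (forall a, (3 <= a < G)%nat -> r' a = r a) /\ recs_at r' G (dummy :: p)).
  split; [lia|]. split; [|split].
  - exists [], l. simpl length. repeat split; try lia; auto; try (apply Rg; assumption).
    intros; apply Rf; lia.
  - intros j r2 n2 (p & q & Hpq & Hq & B9 & B7 & B2 & B10 & B8 & Bn & B1 & Br & Bg) Hj.
    destruct q as [|x q]; [discriminate|].
    assert (Hm : m = (length p + S (length q))%nat)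
      by (unfold m; rewrite Hpq, length_app; reflexivity).
    destruct (Hl (length p) x) as (Hf & E0 & E1 & E2 & E3).
    { rewrite Hpq, nth_error_app2, Nat.sub_diag by lia. reflexivity. }
    set (f := n (s + K + 2 + length p)%nat) in *.
    apply (wp_record B f).
    + upd. repeat split; try lia. rewrite B9. upd. apply Bn. lia.
    + assumption.
    + upd. rewrite B2, B7, B9, B10. upd. rewrite Bn by lia.
      intros r3 n3 C0 C1 C2 C3 C4 C5 C6 Cr Cn.
      split; [rewrite Cn by lia; upd; reflexivity|].
      exists (p ++ [x]), q. rewrite !length_app. cbn [length] in *. rewrite !length_app. cbn [length].
      split; [rewrite Hpq, <- app_assoc; reflexivity|].
      repeat (split; [first [lia | rewrite Cn by lia; upd; assumption]|]).
      split; [intros a Ha; rewrite Cn by lia; upd; apply Bn; lia|].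
      split; [rewrite Cr by lia; assumption|].
      split; [intros a Ha; rewrite Cr by lia; apply Br; lia|].
      rewrite app_comm_cons. apply recs_at_snoc; cbn [length].
      * eapply recs_at_frame; [exact Bg|]. cbn [length]. intros a Ha. apply Cr; lia.
      * rewrite C0, E0. reflexivity.
      * rewrite C1, Br, <- E1 by lia; f_equal; lia.
      * rewrite C2, Br, <- E2 by lia; f_equal; lia.
      * rewrite C3, Br, <- E3 by lia; f_equal; lia.
  - intros r2 n2 (p & q & Hpq & Hq & B9 & B7 & B2 & B10 & B8 & Bn & B1 & Br & Bg) Hj.
    destruct q; [|discriminate]. rewrite app_nil_r in Hpq. subst p.
    apply wp_Mov; [lia|]. apply wp_Mov; [lia|]. upd. rewrite !Bn by lia.
    apply HQ; upd; auto.
    + repeat split; upd; cbn [length]; try lia;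
      apply Bg in H; apply H.
    + rewrite Br by lia. lra.
Qed.

Definition setup_cmd (K : nat) : cmd :=
  count_cmd ;; move_N_cmd K ;; move_R_cmd K ;; decode_cmd K ;; repair_cmd ;; table_cmd K.

(* The values [o = 1, 2, 3] (threshold, yes, no) of tree [t] after setup. *)
Definition shifted (r : nat -> R) (m t o : nat) : R :=
  if (m <=? 1)%nat then r (3 * t + o)%nat
  else match t, o with
       | O, 2%nat => r 2%nat - r 3%nat
       | O, 3%nat => 0
       | 1%nat, 2%nat => r 5%nat + r 3%nat
       | 1%nat, 3%nat => r 6%nat + r 3%nat
       | _, _ => r (3 * t + o)%nat
       end.

Lemma wp_setup B K d l Q r n :
  let m := length l in
  (50 <= K /\ n 0 = d /\ n 1 = m /\ 3 * (m + d) <= B)%nat ->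
  (m = 1%nat -> r 6%nat = 0) ->
  (forall t x, nth_error l t = Some x -> let f := n (2 + t)%nat in
     (f < d)%nat /\ rc x = code (negb (n (2 + m + f)%nat =? 0)%nat) f /\
     rt x = shifted r m t 1 /\ ry x = shifted r m t 2 /\ rn x = shifted r m t 3) ->
  (forall G r' n', (K <= G)%nat -> ready G (dummy :: l) r' n' -> r' 0%nat = 0 -> r' 1%nat = 1 ->
     r' 2%nat = r 0%nat -> n' 3%nat = d -> Q r' n') ->
  wp B (setup_cmd K) Q r n.
Proof.
  intros m HK H6 Hl HQ. unfold setup_cmd. cbn [wp].
  apply wp_count; [lia|]. intros r1 n1 A2 A3 A5 A6 Ar A1 An.
  apply wp_move_N; [lia|]. intros n2 B1 Bn.
  apply (wp_move_R B K (m + d)); [lia|]. intros r3 n3 C1 C2 C7 Cn Cr.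
  apply (wp_decode B K m d); [lia| |].
  (* The power of two was left in real register 3, so its copy lies three cells above [E]. *)
  { rewrite C7, Cr by lia. rewrite A3. f_equal. lia. }
  intros r4 n4 D3 D4 D6 Dn Dr.
  set (E := (3 * (m + d) + K)%nat) in *.
  apply (wp_repair B E); [rewrite D6, Dn by lia; lia|]. rewrite D4.
  intros r5 n5 v F3 F2 F0 Fr Fn.
  assert (Hcr : forall a, (a <= 3 * (m + d) \/ a < K)%nat -> r4 (E + a)%nat = r1 a).
  { intros a Ha. rewrite Dr by lia. auto. }
  refine (wp_table B K (m + d) E (6 * (m + d) + 2 * K) l Q r5 n5 _ _ _).
  - rewrite !Fn by lia. rewrite D4, !Dn by lia. lia.
  - intros t x Hx. pose proof (proj1 (nth_error_Some l t) ltac:(congruence)) as Ht.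
    destruct (Hl t x Hx) as (Gf & G0 & G1 & G2 & G3). fold m in Ht.
    assert (HN : forall a, (2 <= a < m + d + 2)%nat -> n5 (m + d + K + a)%nat = n a).
    { intros a Ha. rewrite Fn, Dn, Cn by lia. replace (m + d)%nat with (n1 1%nat) by lia.
      rewrite Bn by lia. apply An. lia. }
    cbv zeta. fold m.
    replace (m + d + K + 2 + t)%nat with (m + d + K + (2 + t))%nat by lia. rewrite HN by lia.
    replace (m + d + K + 2 + m + n (2 + t)%nat)%nat
      with (m + d + K + (2 + m + n (2 + t)%nat))%nat by lia. rewrite HN by lia.
    split; [lia|]. split; [assumption|].
    rewrite G1, G2, G3. clear G0 G1 G2 G3 HN Hx Gf.
    replace (E + 1 + 3 * t)%nat with (E + (3 * t + 1))%nat by lia.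
    replace (E + 2 + 3 * t)%nat with (E + (3 * t + 2))%nat by lia.
    replace (E + 3 + 3 * t)%nat with (E + (3 * t + 3))%nat by lia.
    assert (Hr5 : forall a, (a <> 2 /\ a <> 3 /\ a <= 3 * (m + d))%nat -> r5 (E + a)%nat = r1 a).
    { intros a Ha. rewrite Fr by lia. apply Hcr. lia. }
    assert (E2 : r5 (E + 2)%nat = r 2%nat - r 3%nat + v).
    { rewrite F2, Hcr by lia. rewrite A2. reflexivity. }
    assert (Ev : v = if (m <=? 1)%nat then r 6%nat + r 3%nat else 0).
    { unfold v. rewrite Hcr by lia. rewrite A6. reflexivity. }
    unfold shifted. destruct (Nat.leb_spec m 1) as [Hm|Hm].
    (* Without a tree 1, register 6 was 0 before the shift, so [v] is exactly the no-value of tree 0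
       and the shift is undone. *)
    + assert (t = 0)%nat by lia. subst t. rewrite H6 in Ev by lia.
      cbn [Nat.mul Nat.add]. rewrite E2, F3, Hr5, Ar, Ev by lia. repeat split; lra.
    + destruct t as [|[|t]].
      * cbn [Nat.mul Nat.add]. rewrite E2, F3, Hr5, Ar, Ev by lia. repeat split; lra.
      * cbn [Nat.mul Nat.add]. rewrite !Hr5 by lia. rewrite (Ar 4%nat) by lia. auto.
      * rewrite !Hr5, !Ar by lia. auto.
  - intros r6 n6 I1 I2 I3 I4 I5. eapply HQ; [|exact I1|assumption|assumption| |].
    + lia.
    + rewrite I4, F0. replace E with (E + 0)%nat by lia. rewrite Hcr by lia. apply Ar. lia.
    + rewrite I5, Fn by lia. assumption.
Qed.

(** * Correctness of the reduction *)

Lemma sumf_cons {A} (f : A -> R) a l : sumf f (a :: l) = f a + sumf f l.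
Proof. reflexivity. Qed.

Lemma sumf_ext {A} (f g : A -> R) l :
  (forall x, In x l -> f x = g x) -> sumf f l = sumf g l.
Proof. induction l; simpl; intros H; [reflexivity|]. rewrite H, IHl; auto. Qed.

Lemma sumf_le {A} (f g : A -> R) l :
  (forall x, In x l -> f x <= g x) -> sumf f l <= sumf g l.
Proof.
  induction l as [|a l IH]; simpl; intros H; [lra|].
  pose proof (H a (or_introl eq_refl)). specialize (IH (fun x Hx => H x (or_intror Hx))). lra.
Qed.

Lemma sumf_plus {A} (f g : A -> R) l : sumf (fun x => f x + g x) l = sumf f l + sumf g l.
Proof. induction l; simpl; [lra|]. rewrite IHl. lra. Qed.

Lemma sumf_map {A B} (h : A -> B) (f : B -> R) l :
  sumf f (map h l) = sumf (fun x => f (h x)) l.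
Proof. induction l; simpl; [reflexivity|]. rewrite IHl. reflexivity. Qed.

Lemma sumf_zero {A} (l : list A) : sumf (fun _ => 0) l = 0.
Proof. induction l; simpl; [reflexivity|]. rewrite IHl. lra. Qed.

Lemma sumf_single (h : nat -> R) a d :
  (a < d)%nat -> sumf (fun f => if (a =? f)%nat then h f else 0) (seq 0 d) = h a.
Proof.
  induction d as [|d IH]; intros Ha; [lia|]. rewrite seq_S, sumf_snoc. simpl (0 + d)%nat.
  destruct (Nat.eqb_spec a d) as [->|Hne].
  - rewrite (sumf_ext _ (fun _ => 0)), sumf_zero; [lra|].
    intros f Hf. apply in_seq in Hf. destruct (Nat.eqb_spec d f); [lia|reflexivity].
  - rewrite IH by lia. lra.
Qed.

Lemma prob_up g s : / (1 + exp (- s)) >= 1 / 2 + g <-> up_ok g s.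
Proof.
  unfold up_ok. replace (0 - s) with (- s) by lra. pose proof (exp_pos (- s)) as He.
  set (D := 1 + exp (- s)). assert (HD : 0 < D) by (unfold D; lra).
  assert (HDi : / D * D = 1) by (apply Rinv_l; lra).
  replace (exp (- s) + 1) with D by (unfold D; lra). split; intros H.
  - assert ((1 / 2 + g) * D <= / D * D) by (apply Rmult_le_compat_r; lra). lra.
  - apply Rle_ge. apply Rmult_le_reg_r with D; lra.
Qed.

Lemma prob_dn g s : / (1 + exp (- s)) <= 1 / 2 - g <-> dn_ok g s.
Proof.
  unfold dn_ok. replace (0 - s) with (- s) by lra. pose proof (exp_pos (- s)) as He.
  set (D := 1 + exp (- s)). assert (HD : 0 < D) by (unfold D; lra).
  assert (HDi : / D * D = 1) by (apply Rinv_l; lra).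
  replace (exp (- s) + 1) with D by (unfold D; lra). split; intros H.
  - assert (/ D * D <= (1 / 2 - g) * D) by (apply Rmult_le_compat_r; lra). lra.
  - apply Rmult_le_reg_r with D; lra.
Qed.

Lemma exp_le s s' : s <= s' -> exp s <= exp s'.
Proof. intros [H| ->]; [left; apply exp_increasing; assumption|right; reflexivity]. Qed.

Lemma up_ok_mono g s s' : 0 <= g -> s <= s' -> up_ok g s -> up_ok g s'.
Proof.
  unfold up_ok. intros Hg Hs H. pose proof (exp_le (0 - s') (0 - s) ltac:(lra)). nra.
Qed.

(** The sign of [1 - g - g] follows from the test itself: its product with a positive factor is at
    least 2. *)
Lemma dn_ok_mono g s s' : s' <= s -> dn_ok g s -> dn_ok g s'.
Proof.
  unfold dn_ok. intros Hs H. pose proof (exp_le (0 - s) (0 - s') ltac:(lra)).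
  pose proof (exp_pos (0 - s)). assert (0 < 1 - g - g) by nra. nra.
Qed.

(** An informative existential, so that the values for all features can be collected into one input
    function without choice. *)
Lemma mx_attained L low c l : {v : R | mx L low c l = part L c v}.
Proof.
  unfold mx. assert (H : forall a, {v | a = part L c v} ->
    {v | fold_left (fun a x => Rmax a (part L c (rt x))) l a = part L c v}).
  { induction l as [|x l IH]; intros a Ha; simpl; [assumption|]. apply IH.
    unfold Rmax. destruct (Rle_dec a (part L c (rt x))); [eexists; reflexivity|assumption]. }
  apply H. eexists; reflexivity.
Qed.

Lemma mn_attained L low c l : {v : R | mn L low c l = part L c v}.
Proof.
  unfold mn. assert (H : forall a, {v | a = part L c v} ->
    {v | fold_left (fun a x => Rmin a (part L c (rt x))) l a = part L c v}).
  { induction l as [|x l IH]; intros a Ha; simpl; [assumption|]. apply IH.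
    unfold Rmin. destruct (Rle_dec a (part L c (rt x))); [assumption|eexists; reflexivity]. }
  apply H. eexists; reflexivity.
Qed.

Lemma mx_ge L low c l v :
  v = low \/ (exists y, In y l /\ v = rt y) -> part L c v <= mx L low c l.
Proof.
  unfold mx. assert (H : forall a, a <= fold_left (fun a x => Rmax a (part L c (rt x))) l a /\
    forall y, In y l -> part L c (rt y) <= fold_left (fun a x => Rmax a (part L c (rt x))) l a).
  { induction l as [|x l IH]; intros a; simpl; [split; [lra|tauto]|].
    destruct (IH (Rmax a (part L c (rt x)))) as [IH1 IH2].
    pose proof (Rmax_l a (part L c (rt x))). pose proof (Rmax_r a (part L c (rt x))).
    split; [lra|]. intros y [->|Hy]; [lra|auto]. }
  intros [->|(y & Hy & ->)]; apply H; assumption.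
Qed.

Lemma mn_le L low c l v :
  v = low \/ (exists y, In y l /\ v = rt y) -> mn L low c l <= part L c v.
Proof.
  unfold mn. assert (H : forall a, fold_left (fun a x => Rmin a (part L c (rt x))) l a <= a /\
    forall y, In y l -> fold_left (fun a x => Rmin a (part L c (rt x))) l a <= part L c (rt y)).
  { induction l as [|x l IH]; intros a; simpl; [split; [lra|tauto]|].
    destruct (IH (Rmin a (part L c (rt x)))) as [IH1 IH2].
    pose proof (Rmin_l a (part L c (rt x))). pose proof (Rmin_r a (part L c (rt x))).
    split; [lra|]. intros y [->|Hy]; [lra|auto]. }
  intros [->|(y & Hy & ->)]; apply H; assumption.
Qed.

(* Take the largest threshold that is at most [v]. *)
Lemma candidate (L : list rcd) (low v : R) :
  (forall x, In x L -> low < rt x) ->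
  exists w, (w = low \/ exists y, In y L /\ w = rt y) /\
    forall x, In x L -> ev w x = ev v x.
Proof.
  intros Hlow.
  assert (H : exists w, (w = low \/ (exists y, In y L /\ w = rt y) /\ w <= v) /\
    forall x, In x L -> (w < rt x <-> v < rt x)).
  { induction L as [|x L IH].
    - exists low. split; [auto|]. intros x [].
    - destruct IH as (w & Hw & Hx); [intros; apply Hlow; simpl; auto|].
      destruct (Rlt_dec v (rt x)) as [Hv|Hv]; [|destruct (Rlt_dec w (rt x)) as [Hwx|Hwx]].
      + exists w. split.
        * destruct Hw as [Hw|[(y & Hy & Hw) Hwv]]; [auto|right; split; [|assumption]].
          exists y. simpl. auto.
        * intros z [<-|Hz]; [|auto]. split; [auto|intros _].
          destruct Hw as [->|[_ Hwv]]; [apply Hlow; simpl; auto|lra].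
      + exists (rt x). split.
        * right. split; [exists x; simpl; auto|lra].
        * intros z [<-|Hz]; [split; lra|]. specialize (Hx z Hz). split; intros Hl; [|lra].
          apply Hx. lra.
      + exists w. split.
        * destruct Hw as [Hw|[(y & Hy & Hw) Hwv]]; [auto|right; split; [|assumption]].
          exists y. simpl. auto.
        * intros z [<-|Hz]; [split; lra|auto]. }
  destruct H as (w & Hw & Hx). exists w. split; [tauto|].
  intros x Hin. specialize (Hx x Hin). unfold ev.
  destruct (Rlt_dec w (rt x)), (Rlt_dec v (rt x)); tauto.
Qed.

Lemma code_neg f : code false f < 0.
Proof. unfold code. rewrite S_INR. pose proof (pos_INR f). lra. Qed.

Lemma code_pos f : 0 < code true f.
Proof. unfold code. rewrite S_INR. pose proof (pos_INR f). lra. Qed.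

Lemma code_false_inj f f' : code false f = code false f' -> f = f'.
Proof.
  unfold code. intros H. assert (E : INR (S f) = INR (S f')) by lra.
  apply INR_eq in E. lia.
Qed.

Lemma look_none low ov c : (forall y, In y ov -> rc y <> c) -> look low ov c = low.
Proof.
  induction ov as [|y ov IH]; intros H; simpl; [reflexivity|].
  destruct (Req_dec_T (rc y) c) as [E|E]; [elim (H y); simpl; auto|].
  apply IH. intros; apply H; simpl; auto.
Qed.

Lemma look_pad low ov j c : c <> 0 -> look low (repeat dummy j ++ ov) c = look low ov c.
Proof.
  intros Hc. induction j as [|j IH]; simpl; [reflexivity|].
  destruct (Req_dec_T 0 c); [congruence|assumption].
Qed.

(** Each fixed feature gets one record: one of its own whose threshold imitates [x f], or [dummy] if
    [low] does. The condition on the codes in [ov] ensures, together with [NoDup], that a feature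
    given [dummy] is not assigned by the rest of the tuple. *)
Lemma overrides_exist L low (x : nat -> R) fs :
  In dummy L -> (forall y, In y L -> low < rt y) -> NoDup fs ->
  exists ov, length ov = length fs /\ incl ov L /\
    (forall y, In y ov -> rc y = 0 \/ exists f, In f fs /\ rc y = code false f) /\
    forall f y, In f fs -> In y L -> rc y = code false f ->
      ev (look low ov (rc y)) y = ev (x f) y.
Proof.
  intros Hd Hlow. induction fs as [|f fs IH]; intros Hnd.
  - exists []. repeat split; try (intros ? []; fail); intros ? ? [].
  - inversion Hnd as [|? ? Hf Hnd']; subst. destruct (IH Hnd') as (ov & H1 & H2 & H3 & H4).
    (* A record in the tuple assigns its threshold to its own feature, so the candidate must be
       sought among the records of [f]. *)
    pose (Lf := filter (fun y => if Req_dec_T (rc y) (code false f) then true else false) L).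
    assert (HLf : forall y, In y Lf <-> In y L /\ rc y = code false f).
    { intros y. unfold Lf. rewrite filter_In.
      destruct (Req_dec_T (rc y) (code false f)); intuition congruence. }
    destruct (candidate Lf low (x f)) as (w & Hw & Hev).
    { intros y Hy. apply Hlow, HLf, Hy. }
    assert (Hz : exists z, In z L /\ (rc z = 0 \/ rc z = code false f) /\
      look low (z :: ov) (code false f) = w /\
      forall f', f' <> f -> look low (z :: ov) (code false f') = look low ov (code false f')).
    { destruct Hw as [->|(y & Hy & ->)].
      - exists dummy. pose proof (code_neg f).
        split; [assumption|]. split; [left; reflexivity|]. split.
        + rewrite (look_pad low ov 1) by lra. apply look_none.
          intros y Hy Hyc. destruct (H3 y Hy) as [E|(f' & Hf' & E)]; [lra|].
          rewrite E in Hyc. apply code_false_inj in Hyc. subst. contradiction.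
        + intros f' _. apply (look_pad low ov 1). pose proof (code_neg f'). lra.
      - apply HLf in Hy. destruct Hy as [Hy Hyc]. exists y.
        split; [assumption|]. split; [right; assumption|]. cbn [look]. rewrite Hyc. split.
        + destruct (Req_dec_T (code false f) (code false f)); [reflexivity|contradiction].
        + intros f' Hne. destruct (Req_dec_T (code false f) (code false f')) as [E|]; [|reflexivity].
          apply code_false_inj in E. congruence. }
    destruct Hz as (z & Hz1 & Hz2 & Hz3 & Hz4).
    exists (z :: ov). split; [cbn [length]; congruence|]. split; [|split].
    + intros y [<-|Hy]; auto.
    + intros y [<-|Hy].
      * destruct Hz2; [auto|right; exists f; simpl; auto].
      * destruct (H3 y Hy) as [|(f' & ? & ?)]; [auto|right; exists f'; simpl; auto].
    + intros f' y Hf' Hy Hyc. rewrite Hyc. destruct (Nat.eq_dec f' f) as [->|Hne].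
      * rewrite Hz3. apply Hev, HLf. auto.
      * rewrite Hz4 by assumption. rewrite <- Hyc. apply H4; auto.
        destruct Hf'; [congruence|assumption].
Qed.

(** * The table of an ensemble *)

Definition rec_of (F : nat -> bool) (s : stump) : rcd :=
  Rcd (code (F (st_feat s)) (st_feat s)) (st_thr s) (st_yes s) (st_no s).

Definition table (F : nat -> bool) (E : list stump) : list rcd := dummy :: map (rec_of F) E.

Lemma part_table F E f v :
  part (table F E) (INR (S f)) v =
  sumf (fun s => if F (st_feat s) then if (st_feat s =? f)%nat then ev v (rec_of F s) else 0 else 0) E.
Proof.
  unfold part, table. cbn [sumf fold_right dummy rc].
  fold (sumf (fun x => if Req_dec_T (rc x) (INR (S f)) then ev v x else 0) (map (rec_of F) E)).
  rewrite sumf_map. pose proof (code_pos f) as Hp. cbn [code] in Hp.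
  destruct (Req_dec_T 0 (INR (S f))); [lra|]. rewrite Rplus_0_l.
  apply sumf_ext. intros s _. cbn [rec_of rc].
  destruct (Req_dec_T (code (F (st_feat s)) (st_feat s)) (INR (S f))) as [Hc|Hc].
  - destruct (F (st_feat s)).
    + cbn [code] in Hc. apply INR_eq in Hc. injection Hc as ->. rewrite Nat.eqb_refl. reflexivity.
    + pose proof (code_neg (st_feat s)). lra.
  - destruct (F (st_feat s)); [|reflexivity].
    destruct (Nat.eqb_spec (st_feat s) f) as [He|]; [|reflexivity].
    elim Hc. rewrite He. reflexivity.
Qed.

Lemma fixpart_table F E low ov :
  fixpart (table F E) low ov =
  sumf (fun s => if F (st_feat s) then 0
                 else ev (look low ov (code false (st_feat s))) (rec_of F s)) E.
Proof.
  unfold fixpart, table. cbn [sumf fold_right dummy rc].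
  fold (sumf (fun x => if Rlt_dec (rc x) 0 then ev (look low ov (rc x)) x else 0)
         (map (rec_of F) E)).
  rewrite sumf_map. destruct (Rlt_dec 0 0); [lra|]. rewrite Rplus_0_l.
  apply sumf_ext. intros s _. cbn [rec_of rc].
  destruct (F (st_feat s)).
  - destruct (Rlt_dec (code true (st_feat s)) 0); [|reflexivity].
    pose proof (code_pos (st_feat s)). lra.
  - destruct (Rlt_dec (code false (st_feat s)) 0) as [|Hn]; [reflexivity|].
    elim Hn. apply code_neg.
Qed.

(** A stump on a free feature below [d] is counted by exactly one term of the second sum, a stump on
    a fixed feature by none. *)
Lemma raw_split (F : nat -> bool) E d (x : nat -> R) :
  Forall (fun s => (st_feat s < d)%nat) E ->
  raw_output E x =
  sumf (fun s => if F (st_feat s) then 0 else ev (x (st_feat s)) (rec_of F s)) E +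
  sumf (fun f => part (table F E) (INR (S f)) (x f)) (seq 0 d).
Proof.
  intros H. erewrite (sumf_ext (fun f => part (table F E) (INR (S f)) (x f)));
    [|intros f _; apply part_table].
  induction H as [|s E Hs HE IH].
  - rewrite (sumf_ext _ (fun _ => 0) (seq 0 d)) by reflexivity. rewrite sumf_zero. cbn. lra.
  - change (raw_output (s :: E) x) with (stump_eval s x + raw_output E x).
    erewrite (sumf_ext _ _ (seq 0 d)); [|intros f _; apply sumf_cons].
    rewrite IH, sumf_plus, sumf_cons.
    assert (Hev : stump_eval s x = ev (x (st_feat s)) (rec_of F s)) by reflexivity.
    destruct (F (st_feat s)).
    + rewrite (sumf_single (fun f => ev (x f) (rec_of F s))) by assumption. lra.
    + rewrite sumf_zero. lra.
Qed.

Lemma accept_iff F E d g k low :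
  Forall (fun s => (st_feat s < d)%nat) E -> 0 <= g ->
  (length (filter (fun f => negb (F f)) (seq 0 d)) <= k)%nat ->
  (forall y, In y (table F E) -> low < rt y) ->
  (exists ov, length ov = k /\ incl ov (table F E) /\ accept (table F E) low d g ov) <->
  exists x1 x2 : nat -> R,
    (forall f, (f < d)%nat -> F f = false -> x1 f = x2 f) /\
    up_ok g (raw_output E x1) /\ dn_ok g (raw_output E x2).
Proof.
  intros HE Hg Hk Hlow. set (L := table F E) in *. split.
  - intros (ov & _ & _ & Hup & Hdn).
    exists (fun f => if F f then proj1_sig (mx_attained L low (INR (S f)) L)
                     else look low ov (code false f)),
           (fun f => if F f then proj1_sig (mn_attained L low (INR (S f)) L)
                     else look low ov (code false f)).
    split; [intros f _ ->; reflexivity|].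
    (* On a fixed feature the inputs take the looked-up value instead of the extremal one; this does
       not change [part], since no record has the positive code of that feature. *)
    assert (Hpart : forall f v w, (F f = true -> v = w) ->
      part L (INR (S f)) v = part L (INR (S f)) w).
    { intros f v w Hvw. unfold L. rewrite !part_table. apply sumf_ext. intros s _.
      destruct (F (st_feat s)) eqn:EF; [|reflexivity].
      destruct (Nat.eqb_spec (st_feat s) f) as [<-|]; [|reflexivity].
      rewrite Hvw; auto. }
    assert (Hfix : forall x : nat -> R, (forall f, F f = false -> x f = look low ov (code false f)) ->
      raw_output E x = fixpart L low ov + sumf (fun f => part L (INR (S f)) (x f)) (seq 0 d)).
    { intros x Hx. rewrite (raw_split F E d) by assumption. unfold L. f_equal.
      rewrite fixpart_table. apply sumf_ext. intros s _.
      destruct (F (st_feat s)) eqn:EF; [reflexivity|]. rewrite Hx; auto. }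
    split; rewrite Hfix by (intros f ->; reflexivity).
    + replace (sumf _ (seq 0 d)) with (hi L low d); [assumption|].
      apply sumf_ext. intros f _. destruct (mx_attained L low (INR (S f)) L) as [v Hv] eqn:Ev.
      rewrite Hv. apply Hpart. intros ->. reflexivity.
    + replace (sumf _ (seq 0 d)) with (lo L low d); [assumption|].
      apply sumf_ext. intros f _. destruct (mn_attained L low (INR (S f)) L) as [v Hv] eqn:Ev.
      rewrite Hv. apply Hpart. intros ->. reflexivity.
  - intros (x1 & x2 & Hx & Hup & Hdn).
    set (fs := filter (fun f => negb (F f)) (seq 0 d)) in *.
    assert (Hdummy : In dummy L) by (left; reflexivity).
    destruct (overrides_exist L low x1 fs) as (ov & H1 & H2 & _ & H4);
      [assumption|assumption|apply NoDup_filter, seq_NoDup|].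
    (* There may be fewer than [k] fixed features; dummies pad the tuple to length [k] without
       assigning anything. *)
    exists (repeat dummy (k - length ov) ++ ov). split; [|split].
    + rewrite length_app, repeat_length. lia.
    + apply incl_app; [|assumption]. intros y Hy. apply repeat_spec in Hy. subst. assumption.
    + assert (Hfix : forall x : nat -> R, (forall f, (f < d)%nat -> F f = false -> x f = x1 f) ->
        raw_output E x = fixpart L low (repeat dummy (k - length ov) ++ ov) +
          sumf (fun f => part L (INR (S f)) (x f)) (seq 0 d)).
      { intros x Hxx. rewrite (raw_split F E d) by assumption. unfold L. f_equal.
        rewrite fixpart_table. apply sumf_ext. intros s Hs.
        destruct (F (st_feat s)) eqn:EF; [reflexivity|].
        pose proof (code_neg (st_feat s)). rewrite look_pad by lra.
        pose proof (proj1 (Forall_forall _ _) HE s Hs) as Hd. cbv beta in Hd.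
        rewrite Hxx by assumption. symmetry.
        assert (Hrc : rc (rec_of F s) = code false (st_feat s)) by (cbn; rewrite EF; reflexivity).
        rewrite <- Hrc. apply H4; [|right; apply in_map; assumption|assumption].
        apply filter_In. split; [apply in_seq; lia|rewrite EF; reflexivity]. }
      assert (Hcand : forall c v, exists w, (w = low \/ exists y, In y L /\ w = rt y) /\
        part L c w = part L c v).
      { intros c v. destruct (candidate L low v Hlow) as (w & Hw & Hev). exists w.
        split; [assumption|]. apply sumf_ext. intros y Hy. rewrite Hev by assumption. reflexivity. }
      (* The tuple was built from [x1] but fits [x2] too, since both agree on the fixed features. *)
      rewrite Hfix in Hup by reflexivity. rewrite Hfix in Hdn by (intros; symmetry; auto).
      split; [eapply up_ok_mono|eapply dn_ok_mono]; try eassumption;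
        apply Rplus_le_compat_l, sumf_le; intros f _.
      * destruct (Hcand (INR (S f)) (x1 f)) as (w & Hw & <-). apply mx_ge, Hw.
      * destruct (Hcand (INR (S f)) (x2 f)) as (w & Hw & <-). apply mn_le, Hw.
Qed.

(** The ensemble that ends up in the table: with fewer than two trees the machine undoes the shift,
    so nothing changes in that case. *)
Definition shift_trees (E : list stump) : list stump :=
  match E with
  | s0 :: s1 :: E =>
      Stump (st_feat s0) (st_thr s0) (st_yes s0 - st_no s0) 0 ::
      Stump (st_feat s1) (st_thr s1) (st_yes s1 + st_no s0) (st_no s1 + st_no s0) :: E
  | _ => E
  end.

Lemma raw_shift E x : raw_output (shift_trees E) x = raw_output E x.
Proof.
  destruct E as [|s0 [|s1 E]]; try reflexivity.
  unfold raw_output, stump_eval. cbn.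
  destruct (Rlt_dec (x (st_feat s0)) (st_thr s0)), (Rlt_dec (x (st_feat s1)) (st_thr s1)); lra.
Qed.

Lemma length_shift E : length (shift_trees E) = length E.
Proof. destruct E as [|s0 [|s1 E]]; reflexivity. Qed.

Lemma Forall_shift d E :
  Forall (fun s => (st_feat s < d)%nat) E ->
  Forall (fun s => (st_feat s < d)%nat) (shift_trees E).
Proof.
  destruct E as [|s0 [|s1 E]]; intros H; try assumption.
  inversion H as [|? ? H0 H']; subst. inversion H' as [|? ? H1 HE]; subst.
  repeat constructor; assumption.
Qed.

Lemma sensitive_shift I :
  sensitive I <-> exists x1 x2 : nat -> R,
    (forall f, (f < inst_d I)%nat -> inst_F I f = false -> x1 f = x2 f) /\
    up_ok (inst_g I) (raw_output (shift_trees (inst_trees I)) x1) /\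
    dn_ok (inst_g I) (raw_output (shift_trees (inst_trees I)) x2).
Proof.
  unfold sensitive, prob_output.
  split; intros (x1 & x2 & H1 & H2 & H3); exists x1, x2; (split; [assumption|]);
    [rewrite !raw_shift|rewrite raw_shift in H2, H3];
    (split; [apply prob_up|apply prob_dn]; assumption).
Qed.

(** * Reading the input encoding *)

Lemma enc_rmem_tree I t s :
  nth_error (inst_trees I) t = Some s ->
  enc_rmem I (3 * t + 1) = st_thr s /\ enc_rmem I (3 * t + 2) = st_yes s /\
  enc_rmem I (3 * t + 3) = st_no s.
Proof.
  intros H.
  assert (Ho : forall o, (o < 3)%nat -> enc_rmem I (3 * t + S o) =
    if Nat.eqb o 0 then st_thr s else if Nat.eqb o 1 then st_yes s else st_no s).
  { intros o Ho. replace (3 * t + S o)%nat with (S (3 * t + o)) by lia. unfold enc_rmem.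
    rewrite <- (Nat.div_unique (3 * t + o) 3 t o) by lia.
    rewrite <- (Nat.mod_unique (3 * t + o) 3 t o) by lia. rewrite H. reflexivity. }
  split; [apply (Ho 0%nat); lia|]. split; [apply (Ho 1%nat); lia|apply (Ho 2%nat); lia].
Qed.

Lemma shifted_tree I t s :
  nth_error (shift_trees (inst_trees I)) t = Some s ->
  st_thr s = shifted (enc_rmem I) (length (inst_trees I)) t 1 /\
  st_yes s = shifted (enc_rmem I) (length (inst_trees I)) t 2 /\
  st_no s = shifted (enc_rmem I) (length (inst_trees I)) t 3.
Proof.
  pose proof (enc_rmem_tree I) as He. unfold shifted.
  destruct (inst_trees I) as [|s0 [|s1 E]]; intros H; cbn [shift_trees length Nat.leb].
  - destruct t; discriminate.
  - apply He in H. intuition congruence.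
  - pose proof (He 0%nat s0 eq_refl) as (A1 & A2 & A3).
    pose proof (He 1%nat s1 eq_refl) as (B1 & B2 & B3).
    cbn [Nat.mul Nat.add] in A1, A2, A3, B1, B2, B3.
    destruct t as [|[|t]].
    + injection H as <-. cbn [st_thr st_yes st_no Nat.mul Nat.add].
      rewrite A1, A2, A3. auto.
    + injection H as <-. cbn [st_thr st_yes st_no Nat.mul Nat.add].
      rewrite A3, B1, B2, B3. auto.
    + destruct (He (S (S t)) s H) as (C1 & C2 & C3). rewrite C1, C2, C3. auto.
Qed.

Lemma st_feat_shift E t s :
  nth_error (shift_trees E) t = Some s ->
  exists s', nth_error E t = Some s' /\ st_feat s = st_feat s'.
Proof.
  destruct E as [|s0 [|s1 E]]; [destruct t; discriminate|eauto|].
  destruct t as [|[|t]]; cbn; intros H; [injection H as <-|injection H as <-|]; eauto.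
Qed.

Lemma enc_nmem_feat I t s :
  nth_error (inst_trees I) t = Some s -> enc_nmem I (2 + t) = st_feat s.
Proof.
  intros H. pose proof (proj1 (nth_error_Some (inst_trees I) t) ltac:(congruence)) as Ht.
  unfold enc_nmem. cbn [Nat.add Nat.eqb].
  rewrite (proj2 (Nat.ltb_lt _ _)) by lia.
  replace (S (S t) - 2)%nat with t by lia. rewrite H. reflexivity.
Qed.

Lemma enc_nmem_bit I f :
  (f < inst_d I)%nat ->
  enc_nmem I (2 + length (inst_trees I) + f) = if inst_F I f then 1%nat else 0%nat.
Proof.
  intros H. unfold enc_nmem. cbn [Nat.add Nat.eqb].
  rewrite (proj2 (Nat.ltb_ge _ _)), (proj2 (Nat.ltb_lt _ _)) by lia.
  replace (S (S (length (inst_trees I) + f)) - 2 - length (inst_trees I))%nat with f by lia.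
  reflexivity.
Qed.

(** * The complete program *)

Definition solver (k : nat) : cmd := setup_cmd (50 + 4 * k) ;; main_cmd k.

(** The factor 3 comes from the longest loop, which copies [3 * (m + d)] real cells; the other
    counters are bounded by [inst_size I]. *)
Lemma wp_solver k I :
  wf_instance I -> (n_fixed I <= k)%nat ->
  wp (3 * inst_size I) (solver k) (fun _ n => n 0%nat <> 0%nat <-> sensitive I)
    (enc_rmem I) (enc_nmem I).
Proof.
  intros [Hwf Hg] Hk. set (E := shift_trees (inst_trees I)).
  set (l := map (rec_of (inst_F I)) E).
  assert (Hlen : length l = length (inst_trees I))
    by (unfold l, E; rewrite length_map, length_shift; reflexivity).
  unfold solver. cbn [wp].
  apply (wp_setup _ (50 + 4 * k) (inst_d I) l); rewrite ?Hlen.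
  - unfold inst_size. cbn. lia.
  - intros H1. unfold enc_rmem. cbn. destruct (inst_trees I) as [|s [|]]; try discriminate.
    reflexivity.
  - intros t x Hx. unfold l in Hx. rewrite nth_error_map in Hx.
    destruct (nth_error E t) as [s|] eqn:Hs; [|discriminate]. injection Hx as <-.
    destruct (st_feat_shift _ _ _ Hs) as (s' & Hs' & Hf).
    rewrite (enc_nmem_feat I t s' Hs'). cbv zeta.
    assert (Hd : (st_feat s' < inst_d I)%nat).
    { apply (proj1 (Forall_forall _ _) Hwf). eapply nth_error_In; eassumption. }
    rewrite enc_nmem_bit by assumption. cbn [rec_of rc rt ry rn]. rewrite Hf.
    split; [assumption|]. split; [destruct (inst_F I (st_feat s')); reflexivity|].
    apply shifted_tree, Hs.
  - intros G r n HK Hrd H0 H1 H2 H3.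
    eapply wp_mono.
    + apply (wp_main _ (50 + 4 * k) G (dummy :: l) (inst_d I) (inst_g I) k); try assumption.
      cbn [length]. rewrite Hlen. unfold inst_size. lia.
    + cbv beta. intros r' n' (low & Hlow & Hn). rewrite Hn, sensitive_shift.
      apply accept_iff; try assumption. apply Forall_shift, Hwf.
Qed.

(* For every fixed k there is a program of the unit-cost real RAM and a
   polynomial bound c * size^e (c, e may depend on k) such that on every
   well-formed instance (depth-1 ensemble, g >= 0) with |calF \ F| <= k the
   program halts within the bound and accepts iff the ensemble is
   (g,F)-sensitive. *)
Theorem theorem2 :
  forall k : nat,
  exists (P : program) (c e : nat),
    forall I : instance,
      wf_instance I ->
      (n_fixed I <= k)%nat ->
      exists s' : state,
        run P (c * inst_size I ^ e)%nat (init_state I) = Some s' /\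
        (output s' = true <-> sensitive I).
Proof.
  intros k. destruct (cost_poly (solver k)) as (C & e & Hcost).
  (* The factor [4 ^ e] absorbs the base of the cost bound: [3 * inst_size I + 1] is at most
     [4 * inst_size I], as the size is positive. *)
  exists (compile (solver k) 0), (C * 4 ^ e)%nat, e. intros I Hwf Hk.
  assert (Hat : code_at (compile (solver k) 0) 0 (compile (solver k) 0)).
  { exists [], []. rewrite app_nil_r. auto. }
  destruct (wp_sound _ _ _ _ _ _ _ Hat (wp_solver k I Hwf Hk)) as (t & r & n & HQ & Ht & Hs).
  exists (State (len (solver k)) r n). split.
  - eapply steps_run; [exact Hs| |].
    (* The program halts by running off the end of its code. *)
    + unfold step. cbn [pc].
      rewrite (proj2 (nth_error_None _ _)); [reflexivity|]. rewrite len_compile. lia.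
    + eapply Nat.le_trans; [exact Ht|]. eapply Nat.le_trans; [apply Hcost|].
      rewrite <- Nat.mul_assoc, <- Nat.pow_mul_l. apply Nat.mul_le_mono_l, Nat.pow_le_mono_l.
      unfold inst_size. lia.
  - rewrite <- HQ. unfold output. cbn [nmem].
    destruct (Nat.eqb_spec (n 0%nat) 0); cbn; split; congruence.
Qed.
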